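(* Let $\mathbf c:(0,1)\to(0,1)$ be a function with the finite restricted invertibility property (see context). Let $\mathcal E$ and $\mathcal G=\{g_k\}_{k\in G}$ be orthonormal bases for a Hilbert space $\mathbb H$, where $G$ is a finitely generated Abelian group, and let $T:\mathbb H\to\mathbb H$ be a bounded linear operator satisfying $\|Te\|=1$ for all $e\in\mathcal E$. Assume that $T\mathcal E=\{Te\}_{e\in\mathcal E}$ is $\ell_1$-localized with respect to $\{g_k\}_{k\in G}$ and that $0<D^-(T\mathcal E;\mathcal G)\le D^+(T\mathcal E;\mathcal G)<\infty$. Then for all $\epsilon,\delta\in(0,1)$ there is a subfamily $\mathcal E_{\epsilon\delta}\subseteq\mathcal E$ such that $T\mathcal E_{\epsilon\delta}=\{Te\}_{e\in\mathcal E_{\epsilon\delta}}$ has uniform density with respect to $\mathcal G$ and (1) $\displaystyle R^+(T\mathcal E_{\epsilon\delta},T\mathcal E;\mathcal G)\ge\frac{1-\epsilon}{\|T\|^2}$; (2) $T\mathcal E_{\epsilon\delta}$ is a Riesz sequence with lower and upper Riesz bounds $\mathbf c(\epsilon)(1-\delta)$ and $\|T\|^2$.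
   Context: Finite restricted invertibility property of $\mathbf c$: $\mathbf c:(0,1)\to(0,1)$ is continuous and monotone, and for every $\epsilon\in(0,1)$, $n\in\mathbb N$, $u>0$, orthonormal basis $\{e_i\}_{i=1}^n$ of $\ell_2^n$ and linear operator $T:\ell_2^n\to\ell_2^n$ with $\|Te_i\|\ge u$ for all $i$, there is $J_\epsilon\subseteq\{1,\dots,n\}$ with $|J_\epsilon|/n\ge(1-\epsilon)u^2/\|T\|^2$ and $\|\sum_{j\in J_\epsilon}b_jTe_j\|^2\ge\mathbf c(\epsilon)u^2\sum_{j\in J_\epsilon}|b_j|^2$ for all scalars $b_j$. (Such a function exists.) $G=\mathbb Z^{d_1}\times\mathbb Z_{N_1}\times\cdots\times\mathbb Z_{N_{d_2}}$ with $d_1,d_2\in\mathbb N$, where $\mathbb Z_N=\{0,1,\dots,N-1\}$ is the cyclic group of order $N$. For $k\in G$, $R>0$ put $B_R(k)=\{g\in G:\|g-k\|_\infty=\max_{1\le j\le d_1+d_2}|g(j)-k(j)|\le R\}$. A family $\{f_i\}$ in $\mathbb H$ is a Riesz sequence with Riesz bounds $0<A\le B<\infty$ if $A\sum|a_i|^2\le\|\sum a_if_i\|^2\le B\sum|a_i|^2$ for all square-summable scalars. Localization: a family $\mathcal F\subseteq\mathbb H$ is $\ell_1$-localized with respect to $\mathcal G=\{g_k\}_{k\in G}$ if there is $r\in\ell_1(G)$ such that for each $f\in\mathcal F$ there is $k\in G$ with $|\langle f,g_n\rangle|\le r(n-k)$ for all $n\in G$. Density (sums over $f\in\mathcal F$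 are over the indexed family, i.e. counted with multiplicity): with $a_f=\big(\sum_{n\in G}|\langle f,g_n\rangle|^2\big)^{-1}$, $$D^-(\mathcal F;\mathcal G)=\liminf_{R\to\infty}\inf_{k\in G}\frac{\sum_{f\in\mathcal F}a_f\sum_{n\in B_R(k)}|\langle f,g_n\rangle|^2}{|B_R(0)|},\quad D^+(\mathcal F;\mathcal G)=\limsup_{R\to\infty}\sup_{k\in G}\frac{\sum_{f\in\mathcal F}a_f\sum_{n\in B_R(k)}|\langle f,g_n\rangle|^2}{|B_R(0)|}.$$ If both agree, $\mathcal F$ has uniform density with respect to $\mathcal G$. For $\mathcal F'\subseteq\mathcal F$ (with $0<D^-(\mathcal F;\mathcal G)\le D^+(\mathcal F;\mathcal G)<\infty$), the relative upper density is $R^+(\mathcal F',\mathcal F;\mathcal G)=D^+(\mathcal F';\mathcal G)/D^-(\mathcal F;\mathcal G)$. *)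

(* Defs.v *)
From HB Require Import structures.
From mathcomp Require Import all_boot all_order all_algebra.
From mathcomp Require Import sesquilinear complex finmap.
From mathcomp Require Import summability.
From mathcomp Require Import all_classical all_reals all_analysis.

Set Implicit Arguments.
Unset Strict Implicit.
Unset Printing Implicit Defensive.

Import Order.TTheory GRing.Theory Num.Theory.
Import numFieldNormedType.Exports.

Local Open Scope classical_set_scope.
Local Open Scope ring_scope.

(* Hilbert spaces may be real or complex, and everything below is uniform in  *)
(* this choice.  The norm of a normed module takes values in the scalar       *)
(* field K; [nrm] is the same norm with values in R.                          *)
Variant scalar_kind := RealScalars | ComplexScalars.

Definition scalar_field (R : realType) (k : scalar_kind) : numFieldType :=
  match k with
  | RealScalars => R : numFieldType
  | ComplexScalars => R[i] : numFieldType
  end.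

Definition scalar_re (R : realType) (k : scalar_kind) : scalar_field R k -> R :=
  match k return scalar_field R k -> R with
  | RealScalars => fun x => x
  | ComplexScalars => fun z => complex.Re z
  end.

Definition scalar_conj (R : realType) (k : scalar_kind) :
    scalar_field R k -> scalar_field R k :=
  match k return scalar_field R k -> scalar_field R k with
  | RealScalars => fun x => x
  | ComplexScalars => fun z : R[i] => (z^*)%C
  end.

Definition nrm (R : realType) (k : scalar_kind)
    (V : normedZmodType (scalar_field R k)) (x : V) : R :=
  scalar_re (`|x| : scalar_field R k).

Definition opnorm (R : realType) (V : Type) (N : V -> R) (T : V -> V) : R :=
  sup [set N (T x) | x in [set x | N x <= 1]].

Section FiniteDimensional.
Context (R : realType) (k : scalar_kind).
Local Notation K := (scalar_field R k).

(* The library norm on column vectors is the max norm, so the structure of    *)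
(* ell_2^n is given explicitly.                                               *)
Definition l2dot (n : nat) (x y : 'cV[K]_n) : K :=
  \sum_i x i 0 * scalar_conj (y i 0).

Definition l2norm (n : nat) (x : 'cV[K]_n) : R :=
  Num.sqrt (\sum_i nrm (x i 0) ^+ 2).

(* n orthonormal vectors of the n-dimensional space ell_2^n form a basis. *)
Definition l2_orthonormal_basis (n : nat) (e : 'I_n -> 'cV[K]_n) : Prop :=
  forall i j, l2dot (e i) (e j) = (i == j)%:R.

Definition finite_restricted_invertibility (c : R -> R) : Prop :=
  [/\ forall eps, 0 < eps < 1 -> 0 < c eps < 1,
      {within `]0, 1[, continuous c},
      {in `]0, 1[ &, {homo c : x y / x <= y}} \/
      {in `]0, 1[ &, {homo c : x y /~ x <= y}} &
      forall (eps : R) (n : nat) (u : R) (e : 'I_n -> 'cV[K]_n)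
             (T : {linear 'cV[K]_n -> 'cV[K]_n}),
        0 < eps < 1 -> (0 < n)%N -> 0 < u ->
        l2_orthonormal_basis e ->
        (forall i, u <= l2norm (T (e i))) ->
        exists J : {set 'I_n},
          #|J|%:R / n%:R >= (1 - eps) * u ^+ 2 / opnorm (@l2norm n) T ^+ 2 /\
          forall b : 'I_n -> K,
            l2norm (\sum_(j in J) b j *: T (e j)) ^+ 2
              >= c eps * u ^+ 2 * \sum_(j in J) nrm (b j) ^+ 2].

End FiniteDimensional.

Section Group.
Context (d1 d2 : nat) (N : 'I_d2 -> nat).

(* Z^d1 x Z_(N_1 + 1) x ... x Z_(N_d2 + 1): as N ranges over all families of  *)
(* naturals, the orders of the cyclic factors range over all positive         *)
(* integers.                                                                  *)
Definition fgab : choiceType :=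
  ({ffun 'I_d1 -> int} * {dffun forall j : 'I_d2, 'I_(N j).+1})%type.

Definition fgab0 : fgab := ([ffun=> 0], [ffun j => 0 : 'I_(N j).+1]).

(* Subtraction in 'I_m.+1 is modulo m.+1. *)
Definition fgab_sub (g h : fgab) : fgab :=
  ([ffun i => g.1 i - h.1 i], [ffun j => g.2 j - h.2 j : 'I_(N j).+1]).

(* The coordinates in a cyclic factor are compared as the integers 0, ..., m. *)
Definition fgab_dist (g h : fgab) : nat :=
  maxn (\max_(i < d1) `|g.1 i - h.1 i|%N)
       (\max_(j < d2) `|(g.2 j)%:Z - (h.2 j)%:Z|%N).

Definition fgab_ball (R : realType) (r : R) (g : fgab) : set fgab :=
  [set h | (fgab_dist h g)%:R <= r].

End Group.

(* A family is given by an index set J : set I and a map f : I -> H, so that  *)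
(* members are counted with multiplicity; a subfamily has the same f and a    *)
(* smaller J.                                                                 *)
Section Hilbert.
Context (R : realType) (k : scalar_kind).
Local Notation K := (scalar_field R k).
Context (H : completeNormedModType K) (ip : {dot H for @scalar_conj R k}).
Context (I : choiceType).

Definition hilbert_norm : Prop := forall x : H, ip x x = `|x| ^+ 2.

Definition bounded_operator (T : H -> H) : Prop :=
  exists M : R, forall x, nrm (T x) <= M * nrm x.

Definition lin_span (J : set I) (f : I -> H) : set H :=
  [set x | exists (A : {fset I}) (a : I -> K),
     [set` A] `<=` J /\ x = \sum_(i <- A) a i *: f i].

Definition orthonormal_basis (J : set I) (f : I -> H) : Prop :=
  (forall i j, J i -> J j -> ip (f i) (f j) = (i == j)%:R) /\
  closure (lin_span J f) = setT.

(* The series converges unconditionally, i.e. along the net of finite sets. *)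
Definition riesz_sequence (J : set I) (f : I -> H) (A B : R) : Prop :=
  [/\ 0 < A, A <= B &
      forall a : I -> K,
        (\esum_(i in J) (nrm (a i) ^+ 2)%:E < +oo)%E ->
        exists2 s : H,
          partial_sum (patch (cst 0) J (fun i => a i *: f i)) @ totally --> s &
          (A%:E * (\esum_(i in J) (nrm (a i) ^+ 2)%:E) <= (nrm s ^+ 2)%:E
            <= B%:E * (\esum_(i in J) (nrm (a i) ^+ 2)%:E))%E].

Section Density.
Context (d1 d2 : nat) (N : 'I_d2 -> nat).
Local Notation G := (fgab d1 N).
Context (g : G -> H).

Definition l1_localized (J : set I) (f : I -> H) : Prop :=
  exists2 r : G -> R, esum.summable setT (EFin \o r) &
    forall i, J i -> exists m : G, forall n : G,
      nrm (ip (f i) (g n)) <= r (fgab_sub n m).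

(* The weight a_f; it is 0 for f = 0, whose coefficients all vanish anyway. *)
Definition weight (x : H) : R :=
  (fine (\esum_(n in [set: G]) (nrm (ip x (g n)) ^+ 2)%:E))^-1.

Definition local_density (J : set I) (f : I -> H) (r : R) (m : G) : \bar R :=
  ((\esum_(i in J) ((weight (f i))%:E *
      (\esum_(n in fgab_ball r m) (nrm (ip (f i) (g n)) ^+ 2)%:E)))
   * ((#|` fset_set (fgab_ball r (fgab0 d1 N))|%:R)^-1)%:E)%E.

Definition lower_density (J : set I) (f : I -> H) : \bar R :=
  limf_einf (fun r : R => ereal_inf (range (local_density J f r))) +oo.

Definition upper_density (J : set I) (f : I -> H) : \bar R :=
  limf_esup (fun r : R => ereal_sup (range (local_density J f r))) +oo.

Definition uniform_density (J : set I) (f : I -> H) : Prop :=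
  lower_density J f = upper_density J f.

(* Only meaningful when the lower density of (J, f) is positive and finite. *)
Definition relative_upper_density (J' J : set I) (f : I -> H) : \bar R :=
  (upper_density J' f * ((fine (lower_density J f))^-1)%:E)%E.

End Density.
End Hilbert.

(* Main.v *)
Require Import Defs.
From HB Require Import structures.
From mathcomp Require Import all_boot all_order all_algebra.
From mathcomp Require Import sesquilinear complex finmap.
From mathcomp Require Import summability.
From mathcomp Require Import all_classical all_reals all_analysis.
From mathcomp Require Import ring lra zify.

Set Implicit Arguments.
Unset Strict Implicit.
Unset Printing Implicit Defensive.

Import Order.TTheory GRing.Theory Num.Theory.
Import numFieldNormedType.Exports.
Local Open Scope classical_set_scope.
Local Open Scope ring_scope.

(** Restricted invertibility holds for each finite part of the family; the point
    is to choose the parts so that the finite selections do not interfere, while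
    little density is lost.

    Each [T e] has a centre [m e] in the group, and its coefficients are dominated
    by the translate of one summable function [w].  Finite upper density bounds
    the number of members with a common centre ([finite_multiplicity]): a large
    cube around the centre captures half of the mass of each.  With bounded
    multiplicity, sums of translates of [w] over the family are controlled by sums
    over the group ([esum_translates_le]).  Two consequences carry the proof.  The
    mass of the family in a large cube agrees with the number of centres in the
    cube up to a small proportion ([count_le_mass], [mass_le_count]).  And the
    inner products of one member with all members centred far away have a small
    sum ([gram_row_far_le]), because at each point of the group one of the two
    coefficients lies in a tail of [w].

    Cut the group into large cubic tiles and keep, in each tile, the members
    centred in a slightly smaller concentric cube.  Their number is at least about
    the lower density times the volume of the tile.  Restricted invertibility on
    the span of these finitely many members, transported to Euclidean space by
    Gram-Schmidt coordinates ([restricted_invertibility_hilbert]), selects a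
    proportion [(1 - eps') / |T|^2] of them with lower bound [c eps'], where [eps']
    is slightly below [eps].  All selections are trimmed to the smallest
    cardinality [n] that occurs ([uniform_restricted_invertibility]).

    The union of the selections has exactly [n] members in every tile, hence
    uniform density [n] over the volume of a tile ([tiled_mass_asymptotics]).  The
    choice of [eps' < eps] pays for the layers between the tiles and for the
    approximations, which gives the relative density.  For the Riesz bounds, the
    squared norm of a finite combination is the sum over the tiles of the squared
    norms of its parts, each bounded below by [c eps'], plus cross terms between
    different tiles, which are small by the row sums of the Gram matrix
    ([nrm_sqr_sum_blocks]).  Limits of finite combinations inherit the bounds
    ([riesz_sequence_finite]). *)

(** * Real and complex scalars *)

Section Scalars.
Context (R : realType) (k : scalar_kind).
Local Notation K := (scalar_field R k).
Local Notation re := (@scalar_re R k).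
Local Notation conj := (@scalar_conj R k).

Lemma scalar_reD (x y : K) : re (x + y) = re x + re y.
Proof. by case: k x y => //= -[a b] [c d]. Qed.

Lemma scalar_reN (x : K) : re (- x) = - re x.
Proof. by case: k x => //= -[a b]. Qed.

Lemma scalar_re0 : re 0 = 0.
Proof. by case: k. Qed.

Lemma scalar_re1 : re 1 = 1.
Proof. by case: k. Qed.

Lemma scalar_re_sum (I : Type) (s : seq I) (P : pred I) (f : I -> K) :
  re (\sum_(i <- s | P i) f i) = \sum_(i <- s | P i) re (f i).
Proof.
by apply: (big_morph re) => [x y|]; rewrite ?scalar_reD ?scalar_re0.
Qed.

Lemma scalar_le (x y : K) : 0 <= x -> 0 <= y -> (x <= y) = (re x <= re y).
Proof.
case: k x y => //= -[a b] [c d]; rewrite !lecE /=.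
by move=> /andP[/eqP <- _] /andP[/eqP <- _]; rewrite eqxx.
Qed.

Lemma scalar_re_ge0 (x : K) : 0 <= x -> 0 <= re x.
Proof. by move=> x0; have := scalar_le (lexx 0) x0; rewrite x0 scalar_re0 => <-. Qed.

Lemma scalar_re_inj (x y : K) : 0 <= x -> 0 <= y -> re x = re y -> x = y.
Proof.
move=> x0 y0 e; apply/eqP.
by rewrite eq_le (scalar_le x0 y0) (scalar_le y0 x0) e lexx.
Qed.

Lemma scalar_reM (x y : K) : 0 <= x -> 0 <= y -> re (x * y) = re x * re y.
Proof.
case: k x y => //= -[a b] [c d]; rewrite !lecE /=.
by move=> /andP[/eqP -> _] /andP[/eqP -> _]; rewrite mulr0 subr0.
Qed.

Lemma scalar_conj_ge0 (x : K) : 0 <= x -> conj x = x.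
Proof.
case: k x => //= -[a b]; rewrite lecE /= => /andP[/eqP -> _].
by rewrite oppr0.
Qed.

Lemma scalar_re_conj (x : K) : re (conj x) = re x.
Proof. by case: k x => //= -[]. Qed.

Lemma scalar_conj0 : conj 0 = 0.
Proof. by rewrite scalar_conj_ge0. Qed.

Lemma scalar_mul_conj (x : K) : x * conj x = `|x| ^+ 2.
Proof. by case: k x => //= x; [rewrite real_normK// num_real|rewrite -sqr_normc]. Qed.

Lemma scalar_norm_conj (x : K) : `|conj x| = `|x|.
Proof.
case: k x => //= x; have : `|(x^*)%C| ^+ 2 = `|x| ^+ 2.
  by rewrite !sqr_normc conjcK mulrC.
by move/eqP; rewrite eqrXn2// => /eqP.
Qed.

Lemma scalar_re_le_norm (x : K) : `|re x| <= re `|x|.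
Proof.
case: k x => //= -[a b] /=; rewrite -sqrtr_sqr ler_wsqrtr// lerDl sqr_ge0 //.
Qed.

Section Norm.
Context (V : normedZmodType K).
Implicit Types x y : V.

Lemma nrm_ge0 x : 0 <= nrm x.
Proof. exact: scalar_re_ge0. Qed.

(** Norms take values in the scalar field; this moves every epsilon argument
    to the reals. *)
Lemma norm_lt_scalar x (e : K) : 0 <= e -> (`|x| < e) = (nrm x < re e).
Proof.
move=> e0; rewrite !lt_neqAle (scalar_le (normr_ge0 x) e0); congr (~~ _ && _).
by apply/eqP/eqP => [xe|/(scalar_re_inj (normr_ge0 x) e0)//]; rewrite /nrm xe.
Qed.

Lemma nrmD x y : nrm (x + y) <= nrm x + nrm y.
Proof. rewrite /nrm -scalar_reD.
by rewrite -(scalar_le (normr_ge0 _) (addr_ge0 (normr_ge0 x) (normr_ge0 y))) ler_normD. Qed.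

Lemma nrmN x : nrm (- x) = nrm x.
Proof. by rewrite /nrm normrN. Qed.

Lemma nrm0 : nrm (0 : V) = 0.
Proof. by rewrite /nrm normr0 scalar_re0. Qed.

Lemma nrm_eq0 x : (nrm x == 0) = (x == 0).
Proof.
apply/eqP/eqP => [e|->]; last exact: nrm0.
by apply/eqP; rewrite -normr_eq0; apply/eqP/scalar_re_inj; rewrite ?scalar_re0.
Qed.

Lemma nrm_sum (I : Type) (s : seq I) (P : pred I) (f : I -> V) :
  nrm (\sum_(i <- s | P i) f i) <= \sum_(i <- s | P i) nrm (f i).
Proof.
elim/big_rec2 : _ => [|i u v _ h]; first by rewrite nrm0.
by rewrite (le_trans (nrmD _ _))// lerD2l.
Qed.

End Norm.

Lemma nrmM (x y : K) : nrm (x * y) = nrm x * nrm y.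
Proof. by rewrite /nrm normrM scalar_reM. Qed.

Lemma nrmZ (V : normedModType K) (a : K) (x : V) : nrm (a *: x) = nrm a * nrm x.
Proof. by rewrite /nrm normrZ scalar_reM. Qed.

Lemma nrm_conj (x : K) : nrm (conj x) = nrm x.
Proof. by rewrite /nrm scalar_norm_conj. Qed.

Lemma scalar_re_mul_conj (x : K) : re (x * conj x) = nrm x ^+ 2.
Proof. by rewrite scalar_mul_conj !expr2 scalar_reM. Qed.

Lemma scalar_re_le_nrm (x : K) : re x <= nrm x.
Proof. exact: le_trans (ler_norm _) (scalar_re_le_norm _). Qed.

Lemma nrm1 : nrm (1 : K) = 1.
Proof. by rewrite /nrm normr1 scalar_re1. Qed.

Lemma exists_scalar_of_real (r : R) : 0 <= r -> exists2 x : K, 0 <= x & re x = r.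
Proof.
by case: k => /= r0; [exists r|exists (r%:C)%C => //; rewrite lecE /= eqxx].
Qed.

End Scalars.

(** * Inner product spaces *)

Section Hilbert.
Context (R : realType) (k : scalar_kind).
Local Notation K := (scalar_field R k).
Local Notation re := (@scalar_re R k).
Local Notation conj := (@scalar_conj R k).
Context (H : completeNormedModType K) (ip : {dot H for conj}).
Hypothesis hH : hilbert_norm ip.
Implicit Types x y z : H.

Lemma ipC x y : ip x y = conj (ip y x).
Proof. by rewrite (hermitian_subproof (s := ip)) expr0 mul1r. Qed.

Lemma ipDl x y z : ip (x + y) z = ip x z + ip y z.
Proof. exact: linearDl. Qed.

Lemma ipBl x y z : ip (x - y) z = ip x z - ip y z.
Proof. exact: linearBl. Qed.

Lemma ipDr x y z : ip z (x + y) = ip z x + ip z y.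
Proof. exact: linearDr. Qed.

Lemma ipBr x y z : ip z (x - y) = ip z x - ip z y.
Proof. exact: linearBr. Qed.

Lemma ip0l x : ip 0 x = 0.
Proof. exact: linear0l. Qed.

Lemma ip0r x : ip x 0 = 0.
Proof. exact: linear0r. Qed.

Lemma ipZl a x y : ip (a *: x) y = a * ip x y.
Proof. exact: linearZl_LR. Qed.

Lemma ipZr a x y : ip x (a *: y) = conj a * ip x y.
Proof. exact: linearZr_LR. Qed.

Lemma ip_suml (J : Type) (s : seq J) (P : pred J) (f : J -> H) y :
  ip (\sum_(i <- s | P i) f i) y = \sum_(i <- s | P i) ip (f i) y.
Proof. exact: linear_sumlz. Qed.

Lemma ip_sumr (J : Type) (s : seq J) (P : pred J) (f : J -> H) y :
  ip y (\sum_(i <- s | P i) f i) = \sum_(i <- s | P i) ip y (f i).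
Proof. exact: linear_sumr. Qed.

Lemma nrm_sqr x : nrm x ^+ 2 = re (ip x x).
Proof. by rewrite hH !expr2 scalar_reM. Qed.

Lemma re_ipC x y : re (ip x y) = re (ip y x).
Proof. by rewrite ipC scalar_re_conj. Qed.

Lemma nrm_sqrD x y : nrm (x + y) ^+ 2 = nrm x ^+ 2 + nrm y ^+ 2 + 2 * re (ip x y).
Proof.
rewrite !nrm_sqr ipDl !ipDr !scalar_reD (re_ipC y x); ring.
Qed.

Lemma nrm_sqrB x y : nrm (x - y) ^+ 2 = nrm x ^+ 2 + nrm y ^+ 2 - 2 * re (ip x y).
Proof.
rewrite !nrm_sqr ipBl !ipBr !scalar_reD !scalar_reN !scalar_reD !scalar_reN.
rewrite (re_ipC y x); ring.
Qed.

Lemma pythagoras_sum (J : eqType) (s : seq J) (c : J -> K) (w : J -> H) :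
  uniq s -> {in s &, forall i j, i != j -> ip (w i) (w j) = 0} ->
  nrm (\sum_(i <- s) c i *: w i) ^+ 2 = \sum_(i <- s) nrm (c i) ^+ 2 * nrm (w i) ^+ 2.
Proof.
elim: s => [|i s ih]; first by rewrite !big_nil nrm0 expr0n.
move=> /= /andP[nis us] o; rewrite !big_cons nrm_sqrD ih//; last first.
  by move=> u v us' vs; apply: o; rewrite in_cons ?us' ?vs orbT.
rewrite nrmZ exprMn ip_sumr [X in re X]big_seq [X in re X]big1.
  by rewrite scalar_re0 mulr0 addr0.
move=> j js.
rewrite ipZl ipZr o ?mulr0// ?in_cons ?eqxx ?js ?orbT//.
by apply: contraNneq nis => ->.
Qed.

Section Bessel.
Context (J : choiceType) (D : set J) (w : J -> H).
Hypothesis hw : forall i j, D i -> D j -> ip (w i) (w j) = (i == j)%:R.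

Lemma orthonormal_nrm i : D i -> nrm (w i) = 1.
Proof.
move=> Di; apply/eqP; rewrite -sqrp_eq1 ?nrm_ge0// nrm_sqr hw// eqxx.
by rewrite scalar_re1.
Qed.

Lemma orthonormal_nrm_sum (s : seq J) (c : J -> K) : uniq s -> {in s, forall i, D i} ->
  nrm (\sum_(i <- s) c i *: w i) ^+ 2 = \sum_(i <- s) nrm (c i) ^+ 2.
Proof.
move=> us sD; rewrite pythagoras_sum//; last first.
  by move=> i j /sD Di /sD Dj ij; rewrite hw// (negPf ij).
rewrite !big_seq; apply: eq_bigr => i /sD Di.
by rewrite orthonormal_nrm// expr1n mulr1.
Qed.

(** Expanding the square around the coefficients of [x] identifies the best
    approximation from the span, and its error. *)
Lemma nrm_sqr_sub_comb (s : seq J) (c : J -> K) x : uniq s -> {in s, forall i, D i} ->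
  nrm (x - \sum_(i <- s) c i *: w i) ^+ 2 =
  nrm x ^+ 2 - \sum_(i <- s) nrm (ip x (w i)) ^+ 2
   + \sum_(i <- s) nrm (c i - ip x (w i)) ^+ 2.
Proof.
move=> us sD; rewrite nrm_sqrB orthonormal_nrm_sum// ip_sumr.
rewrite scalar_re_sum mulr_sumr -addrA -[RHS]addrA; congr (_ + _).
rewrite -!sumrN -!big_split /=; apply: eq_bigr => i _.
rewrite ipZr -!scalar_re_mul_conj.
move: (c i) (ip x (w i)) => a b.
by case: k a b => /= [a b|[a1 a2] [b1 b2] /=]; ring.
Qed.

Lemma bessel (s : seq J) x : uniq s -> {in s, forall i, D i} ->
  \sum_(i <- s) nrm (ip x (w i)) ^+ 2 <= nrm x ^+ 2.
Proof.
move=> us sD; have := nrm_sqr_sub_comb (fun i => ip x (w i)) x us sD.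
rewrite [X in _ - _ + X]big1 => [|i _]; last by rewrite subrr nrm0 expr0n.
by rewrite addr0 -subr_ge0 => <-; exact: sqr_ge0.
Qed.

End Bessel.

(** Bessel's inequality for the single unit vector in the direction of [y]. *)
Lemma cauchy_schwarz x y : nrm (ip x y) <= nrm x * nrm y.
Proof.
have [->|y0] := eqVneq y 0.
  by rewrite ip0r !nrm0 mulr0.
pose w (_ : unit) := (`|y|^-1 : K) *: y.
have ny0 : `|y| != 0 :> K by rewrite normr_eq0.
have cV : conj (`|y|^-1) = `|y|^-1 by rewrite scalar_conj_ge0// invr_ge0.
have hw i j : setT i -> setT j -> ip (w i) (w j) = (i == j)%:R.
  move=> _ _; case: i j => -[]; rewrite /w ipZl ipZr hH cV eqxx expr2.
  by rewrite [X in _ * X]mulrA mulVf// mul1r mulVf.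
have := @bessel unit setT w hw [:: tt] x isT (fun _ _ => I).
rewrite big_seq1 -ler_sqrt ?sqr_ge0// !sqrtr_sqr !ger0_norm ?nrm_ge0//.
rewrite /w ipZr cV nrmM => h.
have e : nrm (ip x y) = nrm (`|y|^-1 : K) * nrm (ip x y) * nrm y.
  rewrite mulrAC -[X in X * _](_ : nrm (`|y|^-1 * `|y| : K) = _).
    by rewrite mulVf// nrm1 mul1r.
  by rewrite nrmM; congr (_ * _); rewrite /nrm normr_id.
by rewrite e ler_wpM2r// nrm_ge0.
Qed.

End Hilbert.

(** * Parseval's identity and Gram-Schmidt coordinates *)

Section Parseval.
Context (R : realType) (k : scalar_kind).
Local Notation K := (scalar_field R k).
Local Notation re := (@scalar_re R k).
Local Notation conj := (@scalar_conj R k).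
Context (H : completeNormedModType K) (ip : {dot H for conj}).
Hypothesis hH : hilbert_norm ip.
Context (J : choiceType) (D : set J) (w : J -> H).
Hypothesis hw : orthonormal_basis ip D w.

(** No combination of the [w i], [i \in A], is closer to [x] than its partial
    Fourier sum, so density of the span passes to the Fourier sums. *)
Lemma orthonormal_basis_approx (x : H) (eta : R) : 0 < eta ->
  exists A : {fset J}, [set` A] `<=` D /\
    nrm (x - \sum_(i <- A) ip x (w i) *: w i) < eta.
Proof.
move=> eta0; case: hw => ow cw.
have [e e0 ee] := exists_scalar_of_real k (ltW eta0).
have e_gt0 : 0 < e.
  rewrite lt_neqAle e0 andbT eq_sym; apply/eqP => e_eq0.
  by move: eta0; rewrite -ee e_eq0 scalar_re0 ltxx.
have : closure (lin_span D w) x by rewrite cw.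
move=> /(_ _ (nbhsx_ballx x e e_gt0))[z [[A [a [AD ->]]]]].
rewrite -ball_normE /= => xz; exists A; split => //.
have uA : uniq A by [].
have DA : {in A, forall i, D i} by move=> i iA; apply: AD.
have h1 := nrm_sqr_sub_comb hH ow (fun i => ip x (w i)) x uA DA.
rewrite [X in _ - _ + X]big1 in h1; last by move=> i _; rewrite subrr nrm0 expr0n.
have h2 := nrm_sqr_sub_comb hH ow a x uA DA.
apply: (@le_lt_trans _ _ (nrm (x - \sum_(i <- A) a i *: w i))).
  rewrite -(@ler_pXn2r _ 2)// ?nnegrE ?nrm_ge0// h1 h2 addr0 lerDl.
  by apply: sumr_ge0 => i _; exact: sqr_ge0.
by rewrite -ee -norm_lt_scalar.
Qed.

(** Replacing [x] by a finite Fourier sum changes the inner product by an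
    arbitrarily small amount.  The case [x = y] is the half of Parseval's
    identity that needs completeness of the system. *)
Lemma nrm_ip_le_esum (x y : H) :
  ((nrm (ip x y))%:E <=
    \esum_(i in D) (nrm (ip x (w i)) * nrm (ip y (w i)))%:E)%E.
Proof.
apply/lee_addgt0Pr => e e0.
have ny1 : 0 < nrm y + 1 by rewrite ltr_wpDl// nrm_ge0.
have [A [AD hA]] := orthonormal_basis_approx x (divr_gt0 e0 ny1).
set z := \sum_(i <- A) _ in hA.
have -> : ip x y = ip (x - z) y + \sum_(i <- A) ip x (w i) * ip (w i) y.
  rewrite ipBl /z ip_suml; under [X in _ - X]eq_bigr do rewrite ipZl.
  by rewrite subrK.
apply: (@le_trans _ _ ((\sum_(i <- A) nrm (ip x (w i)) * nrm (ip y (w i)))%:E + e%:E)%E).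
  rewrite -EFinD lee_fin (le_trans (nrmD _ _))// addrC lerD//.
    rewrite (le_trans (nrm_sum _ _ _))//; apply: ler_sum => i _.
    by rewrite nrmM (ipC _ (w i)) nrm_conj.
  rewrite (le_trans (cauchy_schwarz hH _ _))//.
  apply: (@le_trans _ _ (e / (nrm y + 1) * nrm y)).
    by rewrite ler_wpM2r ?nrm_ge0// ltW.
  by rewrite mulrAC ler_pdivrMr// ler_wpM2l ?ltW// ltrDl.
rewrite leeD2r// esum_ge//; exists [set` A]; first by split.
by rewrite fsbig_finite//= set_fsetK -sumEFin.
Qed.

Lemma nrm_ip_self (x : H) : nrm (ip x x) = nrm x ^+ 2.
Proof.
rewrite (nrm_sqr hH) /nrm; congr re; rewrite ger0_norm// hH.
exact: exprn_ge0.
Qed.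

Lemma parseval (x : H) :
  (\esum_(i in D) (nrm (ip x (w i)) ^+ 2)%:E = (nrm x ^+ 2)%:E)%E.
Proof.
apply/eqP; rewrite eq_le; apply/andP; split; last first.
  by rewrite -nrm_ip_self; exact: (nrm_ip_le_esum x x).
apply: ge_ereal_sup => _ [X [finX XD] <-].
rewrite fsbig_finite//= sumEFin lee_fin (bessel hH hw.1)// ?fset_uniq//.
by move=> i; rewrite in_fset_set// inE => /XD.
Qed.

End Parseval.

Section GramSchmidt.
Context (R : realType) (k : scalar_kind).
Local Notation K := (scalar_field R k).
Local Notation re := (@scalar_re R k).
Local Notation conj := (@scalar_conj R k).
Context (H : completeNormedModType K) (ip : {dot H for conj}).
Hypothesis hH : hilbert_norm ip.

(** A step with vanishing residual contributes the zero vector, so that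
    dependent families are covered. *)
Lemma gram_schmidt (n : nat) (v : nat -> H) : exists w : nat -> H,
  [/\ forall i j, i != j -> ip (w i) (w j) = 0,
      forall i, w i = 0 \/ nrm (w i) = 1 &
      forall i, (i < n)%N -> v i = \sum_(j < n) ip (v i) (w j) *: w j].
Proof.
suff [w [w0 h1 h2 h3]] : exists w : nat -> H,
  [/\ forall i, (n <= i)%N -> w i = 0,
      forall i j, i != j -> ip (w i) (w j) = 0,
      forall i, w i = 0 \/ nrm (w i) = 1 &
      forall i, (i < n)%N -> v i = \sum_(j < n) ip (v i) (w j) *: w j].
  by exists w.
elim: n => [|n [w [w0 wo wn wv]]].
  by exists (fun=> 0); split => // *; [exact: ip0r|left].
pose u := v n - \sum_(j < n) ip (v n) (w j) *: w j.
pose a : K := `|u|^-1.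
have ww x j : ip x (w j) * ip (w j) (w j) = ip x (w j).
  case: (wn j) => [->|e]; first by rewrite ip0r mul0r.
  by rewrite hH (_ : `|w j| = 1) ?expr1n ?mulr1//; apply: scalar_re_inj;
     rewrite // scalar_re1.
have uo j : (j < n)%N -> ip u (w j) = 0.
  move=> jn; rewrite /u ipBl ip_suml (bigD1 (Ordinal jn))//= big1 => [|i ij].
    by rewrite addr0 ipZl ww subrr.
  by rewrite ipZl wo ?mulr0.
have uo' j : ip (w j) u = 0.
  have [jn|nj] := ltnP j n; first by rewrite ipC uo// scalar_conj0.
  by rewrite (w0 _ nj); exact: ip0l.
have uo'' j : ip u (w j) = 0 by rewrite ipC uo' scalar_conj0.
exists (fun i => if i == n then a *: u else w i); split => [i ni|i j ij|i|i].
- by rewrite gtn_eqF// w0// ltnW.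
- case: eqVneq => [ein|_]; case: eqVneq => [ejn|_]; last exact: wo.
  + by rewrite ein ejn eqxx in ij.
  + by rewrite ipZl uo'' mulr0.
  + by rewrite ipZr uo' mulr0.
- case: eqP => // _; have [u0|u0] := eqVneq u 0; first by left; rewrite u0 scaler0.
  right; rewrite nrmZ /a /nrm normfV normr_id -scalar_reM ?invr_ge0//.
  by rewrite mulVf ?normr_eq0// scalar_re1.
- rewrite ltnS leq_eqVlt big_ord_recr /= eqxx => /predU1P[->|lt_in].
    under eq_bigr do rewrite ltn_eqF//.
    have e : v n = u + \sum_(j < n) ip (v n) (w j) *: w j by rewrite /u subrK.
    have e1 : ip (v n) (a *: u) = conj a * ip u u.
      rewrite ipZr [in LHS]e ipDl ip_suml big1 ?addr0// => j _.
      by rewrite ipZl uo' mulr0.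
    have e2 : ip (v n) (a *: u) *: (a *: u) = u.
      have [u0|u0] := eqVneq u 0; first by rewrite u0 !scaler0.
      have nu0 : `|u| != 0 :> K by rewrite normr_eq0.
      rewrite e1 scalerA hH scalar_conj_ge0 ?invr_ge0// expr2 mulrA.
      by rewrite mulVf// mul1r divff// scale1r.
    by rewrite e2 addrC; exact: e.
  under eq_bigr do rewrite ltn_eqF//.
  rewrite -wv// (_ : ip (v i) (a *: u) = 0) ?scale0r ?addr0//.
  rewrite ipZr (wv i)// ip_suml big1 ?mulr0// => j _.
  by rewrite ipZl uo' mulr0.
Qed.

End GramSchmidt.

(** * Restricted invertibility on finite subsets of a Hilbert space *)

Section OperatorNorm.
Context (R : realType) (k : scalar_kind).
Local Notation K := (scalar_field R k).
Context (H : completeNormedModType K) (T : {linear H -> H}).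
Hypothesis hT : bounded_operator T.
Local Notation opT := (opnorm (@nrm R k H) T).

Lemma opnorm_has_sup : has_sup [set nrm (T x) | x in [set x | nrm x <= 1]].
Proof.
case: hT => M hM; split; first by exists (nrm (T 0)), 0 => //=; rewrite nrm0.
exists (Num.max M 0) => _ [x /= x1 <-]; rewrite (le_trans (hM x))//.
rewrite (@le_trans _ _ (Num.max M 0 * nrm x))//.
  by rewrite ler_wpM2r ?nrm_ge0// le_max lexx.
by rewrite ler_piMr// le_max lexx orbT.
Qed.

Lemma opnorm_ge0 : 0 <= opT.
Proof.
apply: le_trans (ub_le_sup opnorm_has_sup.2 _); last by exists 0; rewrite //= nrm0.
exact: nrm_ge0.
Qed.

Lemma nrm_le_opnorm x : nrm (T x) <= opT * nrm x.
Proof.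
have [->|x0] := eqVneq x 0; first by rewrite linear0 nrm0 mulr0.
have nx0 : 0 < nrm x by rewrite lt_neqAle nrm_ge0 eq_sym nrm_eq0 x0.
have nx0' : `|x| != 0 :> K by rewrite normr_eq0.
rewrite -ler_pdivrMr//; apply: ub_le_sup; first exact: opnorm_has_sup.2.
have nV : nrm (`|x|^-1 : K) = (nrm x)^-1.
  apply: (mulIf (lt0r_neq0 nx0)); rewrite mulVf ?lt0r_neq0//.
  rewrite {2}/nrm -[X in _ * scalar_re X]normr_id -nrmM mulVf// nrm1 //.
exists ((`|x|^-1 : K) *: x); rewrite /= ?linearZ nrmZ nV ?mulVf ?lt0r_neq0//.
by rewrite mulrC.
Qed.

End OperatorNorm.

Section RestrictedInvertibility.
Context (R : realType) (k : scalar_kind).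
Local Notation K := (scalar_field R k).
Local Notation conj := (@scalar_conj R k).
Context (H : completeNormedModType K) (ip : {dot H for conj}).
Hypothesis hH : hilbert_norm ip.

Lemma sqr_l2norm n (x : 'cV[K]_n) : l2norm x ^+ 2 = \sum_i nrm (x i 0) ^+ 2.
Proof. by rewrite /l2norm sqr_sqrtr// sumr_ge0// => i _; exact: sqr_ge0. Qed.

Lemma l2norm_ge0 n (x : 'cV[K]_n) : 0 <= l2norm x.
Proof. exact: sqrtr_ge0. Qed.

(** The isometry consists of the coordinates in an orthonormal system obtained
    from [v]: one coordinate for each vector, hence a square matrix. *)
Lemma exists_isometric_matrix n (v : nat -> H) : exists A : 'M[K]_n,
  forall b : 'cV[K]_n, l2norm (A *m b) = nrm (\sum_(i < n) b i 0 *: v i).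
Proof.
have [w [wo wn wv]] := gram_schmidt hH n v.
exists (\matrix_(j, i) ip (v i) (w j)) => b.
apply/eqP; rewrite -(@eqrXn2 _ 2) ?l2norm_ge0 ?nrm_ge0//; apply/eqP.
set x := \sum_(i < n) _.
have -> : x = \sum_(j < n) ip x (w j) *: w j.
  rewrite {1}/x; under eq_bigr => i _ do rewrite (wv i (ltn_ord i)) scaler_sumr.
  rewrite exchange_big; apply: eq_bigr => j _.
  rewrite /x ip_suml scaler_suml; apply: eq_bigr => i _.
  by rewrite ipZl scalerA.
rewrite (pythagoras_sum hH) ?index_enum_uniq//; last first.
  by move=> i j _ _ ij; rewrite wo.
rewrite sqr_l2norm; apply: eq_bigr => j _.
have -> : (\matrix_(j0, i) ip (v i) (w j0) *m b) j 0 = ip x (w j).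
  rewrite mxE /x ip_suml; apply: eq_bigr => i _.
  by rewrite ipZl mxE mulrC.
case: (wn j) => [->|->]; last by rewrite expr1n mulr1.
by rewrite ip0r nrm0 expr0n mul0r.
Qed.

Context (c : R -> R).
Hypothesis hc : finite_restricted_invertibility k c.
Context (T : {linear H -> H}).
Hypothesis hT : bounded_operator T.
Local Notation opT := (opnorm (@nrm R k H) T).

(** The finite-dimensional property applies to the matrix of [T] on the span of
    [A], written in coordinates that preserve all norms.  The norm of this matrix
    is at most that of [T], and replacing it by the larger one weakens the bound
    on the cardinality. *)
Lemma restricted_invertibility_hilbert (eps : R) (A : {fset H}) :
    0 < eps < 1 ->
    {in A &, forall e f, ip e f = (e == f)%:R} ->
    {in A, forall e, nrm (T e) = 1} ->
  exists J : {fset H},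
    [/\ (J `<=` A)%fset, (1 - eps) / opT ^+ 2 * #|` A|%:R <= #|` J|%:R &
        forall a : H -> K, c eps * \sum_(e <- J) nrm (a e) ^+ 2 <=
          nrm (\sum_(e <- J) a e *: T e) ^+ 2].
Proof.
move=> heps oA nA; have [_ _ _ hri] := hc.
have [A0|A_gt0] := posnP #|` A|.
  exists fset0; rewrite A0 fsub0set cardfs0 mulr0; split=> // a.
  by rewrite !big_seq_fset0 nrm0 mulr0 expr0n.
set n := #|` A| in A_gt0 *.
pose e (i : nat) : H := nth 0 A i.
have eA (i : 'I_n) : e i \in A by rewrite mem_nth.
have [M hM] := exists_isometric_matrix n (fun i => T (e i)).
have e_inj : injective (fun i : 'I_n => e i).
  by move=> i j /eqP; rewrite nth_uniq ?fset_uniq// => /eqP/val_inj.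
have hME b : l2norm (M *m b) = nrm (T (\sum_(i < n) b i 0 *: e i)).
  by rewrite hM linear_sum; congr nrm; apply: eq_bigr => i _; rewrite linearZ.
have nE (b : 'cV[K]_n) : nrm (\sum_(i < n) b i 0 *: e i) = l2norm b.
  apply/eqP; rewrite -(@eqrXn2 _ 2) ?l2norm_ge0 ?nrm_ge0//; apply/eqP.
  rewrite sqr_l2norm.
  apply: (@orthonormal_nrm_sum _ _ _ _ hH 'I_n setT (fun i => e i) _ _ _) => //.
  - by move=> i j _ _; rewrite oA// (inj_eq e_inj).
  - exact: index_enum_uniq.
have bd (x : 'cV[K]_n) : l2norm x <= 1 -> l2norm (M *m x) <= opT.
  move=> x1; rewrite hME (le_trans (nrm_le_opnorm hT _))// nE.
  by rewrite ler_piMr// opnorm_ge0.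
have dlt (i j : 'I_n) : (delta_mx i 0 : 'cV[K]_n) j 0 = (j == i)%:R.
  by rewrite mxE andbT.
have nd (i : 'I_n) : l2norm (delta_mx i 0 : 'cV[K]_n) = 1.
  apply/eqP; rewrite -sqrp_eq1 ?l2norm_ge0// sqr_l2norm (bigD1 i)//= big1 => [|j ji].
    by rewrite dlt eqxx nrm1 expr1n addr0.
  by rewrite dlt (negPf ji) nrm0 expr0n.
have Md (i : 'I_n) : l2norm (M *m delta_mx i 0) = 1.
  rewrite hM (bigD1 i)//= big1 => [|j ji].
    by rewrite dlt eqxx scale1r addr0 nA.
  by rewrite dlt (negPf ji) scale0r.
pose opM := opnorm (@l2norm R k n) (mulmx M).
have opM_le : opM <= opT.
  apply: ge_sup; first by exists (l2norm (M *m 0)), 0 => //=;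
    rewrite -[X in X <= _]ger0_norm ?l2norm_ge0// /l2norm big1 ?sqrtr0 ?normr0//
      => i _; rewrite mxE nrm0 expr0n.
  by move=> _ [x /= x1 <-]; exact: bd.
have opM_ge1 : 1 <= opM.
  rewrite -(Md (Ordinal A_gt0)); apply: ub_le_sup.
    by exists opT => _ [x /= x1 <-]; exact: bd.
  by exists (delta_mx (Ordinal A_gt0) 0) => //=; rewrite nd.
have ob : l2_orthonormal_basis (fun i : 'I_n => delta_mx i 0 : 'cV[K]_n).
  move=> i j; rewrite /l2dot (bigD1 i)//= big1 => [|l li].
    rewrite !dlt eqxx mul1r addr0; case: eqP => _; first by rewrite scalar_conj_ge0.
    exact: scalar_conj0.
  by rewrite !dlt (negPf li) mul0r.
have lb i : 1 <= l2norm ((mulmx M : {linear _ -> _}) (delta_mx i 0)) by rewrite /= Md.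
have [J0 [cJ hJ]] := hri eps n 1 _ (mulmx M) heps A_gt0 ltr01 ob lb.
pose J := [fset e i | i : 'I_n in J0]%fset.
have sumJ (V : nmodType) (F : H -> V) :
    \sum_(x <- J) F x = \sum_(i in J0) F (e i).
  rewrite /J big_imfset /= ?big_enum//; last by move=> i j _ _; exact: e_inj.
have cardJ : #|` J| = #|J0|.
  by rewrite card_imfset//= cardE.
exists J; split.
- by apply/fsubsetP => x /imfsetP[i _ ->].
- rewrite cardJ -ler_pdivlMr ?ltr0n//; apply: le_trans cJ.
  rewrite expr1n mulr1 ler_wpM2l//; first by case/andP: heps => _ /ltW; rewrite subr_ge0.
  have op0 : 0 < opM by exact: lt_le_trans opM_ge1.
  by rewrite lef_pV2 ?posrE ?exprn_gt0// ?(lt_le_trans op0)// lerXn2r// nnegrE ltW// (lt_le_trans op0).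
- move=> a; rewrite !sumJ; have := hJ (fun i => a (e i)).
  rewrite expr1n mulr1 => /le_trans; apply.
  under eq_bigr do rewrite scalemxAr.
  rewrite -[X in l2norm X]/(\sum_(j in J0) M *m _) -mulmx_sumr hM.
  rewrite (_ : \sum_(i < n) _ = \sum_(i in J0) a (e i) *: T (e i))//.
  rewrite [RHS]big_mkcond /=; apply: eq_bigr => i _.
  rewrite summxE; case: ifPn => iJ.
    rewrite (bigD1 i)//= big1 => [|j /andP[_ ji]]; last first.
      by rewrite mxE dlt eq_sym (negPf ji) mulr0.
    by rewrite addr0 mxE dlt eqxx mulr1.
  rewrite big1 ?scale0r// => j jJ; rewrite mxE dlt.
  by rewrite (_ : i == j = false) ?mulr0//; apply: contraNF iJ => /eqP ->.
Qed.

End RestrictedInvertibility.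

(** * Unordered sums of nonnegative terms *)

Section Esum.
Context (R : realType).
Local Open Scope ereal_scope.

Lemma esum_exchange (T1 T2 : choiceType) (A : set T1) (B : set T2)
    (a : T1 -> T2 -> \bar R) : (forall i j, A i -> B j -> 0 <= a i j) ->
  \esum_(i in A) \esum_(j in B) a i j = \esum_(j in B) \esum_(i in A) a i j.
Proof.
move=> a0; rewrite !esum_esum//; last by move=> i j Bi Aj; exact: a0.
rewrite (reindex_esum (B `*` A) _ (fun x => (x.2, x.1)))//; split=> //=.
- by move=> [i j] [/=].
- by move=> [i1 i2] [j1 j2] /= _ _ [] -> ->.
- by move=> [i1 i2] [Pi1 Qi2] /=; exists (i2, i1).
Qed.

Lemma esum_subset (T : choiceType) (A B : set T) (a : T -> \bar R) :
  A `<=` B -> (forall i, B i -> 0 <= a i) ->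
  \esum_(i in A) a i <= \esum_(i in B) a i.
Proof.
move=> AB a0; rewrite (esumID A B)// setIidr// leeDl//.
by apply: esum_ge0 => i [/a0].
Qed.

Lemma esum_le_setT (T : choiceType) (A : set T) (a : T -> \bar R) :
  (forall i, 0 <= a i) -> \esum_(i in A) a i <= \esum_(i in [set: T]) a i.
Proof. by move=> a0; apply: esum_subset. Qed.

Lemma esumZl (T : choiceType) (A : set T) (a : T -> \bar R) (r : R) :
  (0 <= r)%R -> (forall i, 0 <= a i) ->
  \esum_(i in A) (r%:E * a i) = r%:E * \esum_(i in A) a i.
Proof.
move=> r0 a0; rewrite /esum -ereal_supZl//; last first.
  by apply/set0P; exists (\sum_(i \in set0) a i); exists set0 => //; exact: fsets_set0.
congr ereal_sup; rewrite image_comp; apply: eq_imagel => X [finX XA] /=.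
by rewrite ge0_mule_fsumr.
Qed.

Lemma esum_cst (T : choiceType) (A : set T) (r : R) : (0 <= r)%R ->
  \esum_(i in A) r%:E = r%:E * \esum_(i in A) (1 : \bar R).
Proof. by move=> r0; rewrite -esumZl//; apply: eq_esum => i _; rewrite mule1. Qed.

Lemma esum1_card (T : choiceType) (A : set T) : finite_set A ->
  \esum_(i in A) (1 : \bar R) = (#|` fset_set A|%:R)%:E.
Proof.
move=> fA; rewrite esum_fset// (eq_fsbigr (cst 1))//.
by rewrite card_fset_sum1// natr_sum -sumEFin fsbig_finite.
Qed.

Lemma esum1_fset (T : choiceType) (A : {fset T}) :
  \esum_(i in [set` A]) (1 : \bar R) = (#|` A|%:R)%:E.
Proof. by rewrite esum1_card// set_fsetK. Qed.

Lemma esum1_finite (T : choiceType) (A : set T) :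
  \esum_(i in A) (1 : \bar R) < +oo -> finite_set A.
Proof.
move=> hA; apply: contrapT => infA.
have : \esum_(i in A) (1 : \bar R) = +oo; last by move=> e; rewrite e ltxx in hA.
apply/eq_infty => t.
have [B BA cB] := infinite_set_fset (Num.truncn t).+1 infA.
apply: le_trans (esum_subset BA _) => //.
rewrite esum1_fset lee_fin (@le_trans _ _ (Num.truncn t).+1%:R)//.
  by rewrite ltW// truncnS_gt.
by rewrite ler_nat.
Qed.

Lemma esum_tail (T : choiceType) (a : T -> \bar R) (eta : R) :
  (forall i, 0 <= a i) -> \esum_(i in [set: T]) a i < +oo -> (0 < eta)%R ->
  exists A : {fset T}, \esum_(i in ~` [set` A]) a i <= eta%:E.
Proof.
move=> a0 aoo eta0.
have fin : \esum_(i in [set: T]) a i \is a fin_num.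
  by rewrite ge0_fin_numE// esum_ge0.
have [_ [X [finX _] <-] hX] := ub_ereal_sup_adherent eta0 fin.
exists (fset_set X); rewrite fset_setK//.
have {hX} : \esum_(i in setT) a i - eta%:E < \sum_(i \in X) a i by exact: hX.
rewrite (esumID X setT)// !setTI (esum_fset finX)//.
set s := \sum_(i \in X) _; set t := \esum_(i in _) _.
have sfin : s \is a fin_num.
  rewrite ge0_fin_numE; last by rewrite /s fsume_ge0.
  by apply: le_lt_trans aoo; rewrite /s -esum_fset//; exact: esum_le_setT.
have tfin : t \is a fin_num.
  by rewrite ge0_fin_numE ?esum_ge0// (le_lt_trans (esum_le_setT _ a0)).
case: s sfin => // s _; case: t tfin => // t _.
rewrite -EFinD lte_fin lee_fin; lra.
Qed.

End Esum.

(** * Cubes and tiles in a finitely generated abelian group *)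

Lemma distz_trans (a b : nat) (x y z : int) :
  (`|x - y| <= a)%N -> (`|y - z| <= b)%N -> (`|x - z| <= a + b)%N.
Proof. lia. Qed.

Lemma distzC (x y : int) : `|x - y|%N = `|y - x|%N.
Proof. lia. Qed.

Section Geometry.
Context (d1 d2 : nat) (N : 'I_d2 -> nat).
Local Notation G := (fgab d1 N).
Local Notation P := {ffun 'I_d1 -> int}.

(** Only the free coordinates matter at large scales: a cube is full in the
    finite factors. *)
Definition cube (L : nat) (p : P) : set G :=
  [set n : G | forall i, (`|n.1 i - p i| <= L)%N].

Lemma cube_trans (a b : nat) (p q : P) (n : G) :
  cube a q n -> (forall i, (`|q i - p i| <= b)%N) -> cube (a + b) p n.
Proof. by move=> h1 h2 i; exact: distz_trans (h1 i) (h2 i). Qed.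

Lemma cube_center (L : nat) (n : G) : cube L n.1 n.
Proof. by move=> i; rewrite subrr. Qed.

Lemma cube_le (a b : nat) (p : P) : (a <= b)%N -> cube a p `<=` cube b p.
Proof. by move=> ab n h i; exact: leq_trans (h i) ab. Qed.

Lemma cube_sub (L : nat) (m n : G) : cube L [ffun=> 0] (fgab_sub n m) <-> cube L m.1 n.
Proof. by split => h i; have := h i; rewrite /= !ffunE subr0. Qed.

Lemma fgab_subK (m : G) : cancel (fun n => fgab_sub n m)
  (fun n => fgab_sub n (fgab_sub (fgab0 d1 N) m)).
Proof.
case=> [n1 n2]; rewrite /fgab_sub /=; congr pair; apply/ffunP => i; rewrite !ffunE.
  by rewrite sub0r opprK subrK.
by rewrite sub0r opprK subrK.
Qed.

Lemma fgab_sub_sub (n m : G) : fgab_sub n (fgab_sub n m) = m.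
Proof.
case: n m => [n1 n2] [m1 m2]; rewrite /fgab_sub /=.
by congr pair; apply/ffunP => i; rewrite !ffunE subKr.
Qed.

Lemma fgab_subl_bij (m : G) : set_bij setT setT (fun n => fgab_sub n m).
Proof.
split => //= [x y _ _|k _]; first exact: (can_inj (fgab_subK m)).
exists (fgab_sub k (fgab_sub (fgab0 d1 N) m)) => //.
rewrite -[X in fgab_sub _ X = _](fgab_sub_sub (fgab0 d1 N)).
exact: fgab_subK.
Qed.

Lemma fgab_subr_bij (n : G) : set_bij setT setT (fun m => fgab_sub n m).
Proof.
split => //= [x y _ _|k _]; last by exists (fgab_sub n k) => //; exact: fgab_sub_sub.
exact: (can_inj (fgab_sub_sub n)).
Qed.

Definition fin_part_card : nat := #|{dffun forall j : 'I_d2, 'I_(N j).+1}|.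

Lemma fin_part_card_gt0 : (0 < fin_part_card)%N.
Proof. by apply/card_gt0P; exists [ffun j => ord0]. Qed.

Definition cube_card (L : nat) : nat := ((2 * L).+1 ^ d1 * fin_part_card)%N.

Lemma cube_card_gt0 L : (0 < cube_card L)%N.
Proof. by rewrite muln_gt0 expn_gt0 fin_part_card_gt0. Qed.

Let offsets (L : nat) : finType := ({ffun 'I_d1 -> 'I_(2 * L).+1} *
  {dffun forall j : 'I_d2, 'I_(N j).+1})%type.

Let cube_point (L : nat) (p : P) (f : offsets L) : G :=
  ([ffun i => p i + (f.1 i)%:Z - L%:Z], f.2).

Let cube_point_inj L p : injective (@cube_point L p).
Proof.
move=> [f h] [f' h'] /= [/ffunP e ->]; congr pair; apply/ffunP => i.
by apply: val_inj; have := e i; rewrite !ffunE => /addIr/addrI[].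
Qed.

Let cube_pointE L p : [set cube_point p f | f in [set: offsets L]] = cube L p.
Proof.
apply/seteqP; split => [_ [[f h] _ <-] i|[n h] hn].
  rewrite /= ffunE; case: (f i) => x /= hx; move: (p i) => y; lia.
have lt_offset (x y : int) : (`|x - y| <= L)%N ->
    (`|(x - y + L%:Z)%R| < (2 * L).+1)%N by lia.
have offsetK (x y : int) : (`|x - y| <= L)%N ->
    y + `|(x - y + L%:Z)%R|%:Z - L%:Z = x by lia.
exists ([ffun i => Ordinal (lt_offset _ _ (hn i))], h) => //; congr pair.
by apply/ffunP => i; rewrite !ffunE; exact: offsetK (hn i).
Qed.

Lemma cube_finite L p : finite_set (cube L p).
Proof. by rewrite -cube_pointE; exact: finite_image. Qed.

Lemma cube_esum1 (R : realType) L p :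
  (\esum_(n in cube L p) (1 : \bar R) = (cube_card L)%:R%:E)%E.
Proof.
rewrite -cube_pointE esum_image; last by move=> ? ? _ _; exact: cube_point_inj.
rewrite (_ : setT = [set` [fset x | x in offsets L]%fset]); last first.
  by apply/seteqP; split => // x _ /=; rewrite !inE.
rewrite esum1_fset; congr (_%:R%:E).
by rewrite card_imfset//= -cardE card_prod card_ffun !card_ord.
Qed.

Definition fin_part_diam : nat := \max_(j < d2) N j.

(** Two coordinates in a cyclic factor never differ by more than the diameter of
    that factor, so a large ball puts no condition on them. *)
Lemma fgab_ball_cube (R : realType) (r : R) (n : G) : fin_part_diam%:R <= r ->
  fgab_ball r n = cube (Num.truncn r) n.1.
Proof.
move=> hr; have r0 : 0 <= r by apply: le_trans hr.
apply/seteqP; split => m; rewrite /fgab_ball /= -truncn_ge_nat// geq_max.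
  by move=> /andP[/bigmax_leqP h _] i; exact: h.
move=> h; apply/andP; split; first by apply/bigmax_leqP => i _; exact: h.
apply/bigmax_leqP => j _; rewrite truncn_ge_nat//; apply: le_trans hr.
rewrite ler_nat (leq_trans _ (leq_bigmax j))//.
by have := ltn_ord (m.2 j); have := ltn_ord (n.2 j); lia.
Qed.

(** The free coordinates are cut into blocks of odd length [2 * rho + 1], so that
    each tile is a cube with a centre. *)
Definition tile (rho : nat) (n : G) : P := [ffun i => (n.1 i %/ (2 * rho).+1%:Z)%Z].
Definition tile_center (rho : nat) (q : P) : P :=
  [ffun i => q i * (2 * rho).+1%:Z + rho%:Z].

Lemma tileE rho q : [set n | tile rho n = q] = cube rho (tile_center rho q).
Proof.
apply/seteqP; split => n /= h.
  move=> i; rewrite -h !ffunE; have := divz_eq (n.1 i) (2 * rho).+1%:Z.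
  have := modz_ge0 (n.1 i) (isT : (2 * rho).+1%:Z != 0).
  have := ltz_pmod (n.1 i) (isT : 0 < (2 * rho).+1%:Z).
  move: (_ %/ _)%Z (_ %% _)%Z => a b; lia.
apply/ffunP => i; rewrite ffunE; have := h i; rewrite ffunE => hi.
have -> : n.1 i = q i * (2 * rho).+1%:Z + (n.1 i - q i * (2 * rho).+1%:Z) by ring.
rewrite divzMDl// divz_small ?addr0//.
by move: hi; move: (q i * _) => a; lia.
Qed.

(** Boundary layers of fixed width are negligible in large cubes, by Bernoulli's
    inequality for the ratio of the side lengths. *)
Lemma cube_card_ratio (R : realType) (a : nat) (eta : R) : 0 < eta ->
  exists L0 : nat, forall L, (L0 <= L)%N ->
    (1 - eta) * (cube_card (L + a))%:R <= (cube_card L)%:R.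
Proof.
move=> eta0.
have bernoulli (x : R) d : 0 <= x <= 1 -> 1 - d%:R * x <= (1 - x) ^+ d.
  move=> /andP[x0 x1]; elim: d => [|d ih]; first by rewrite mul0r subr0 expr0.
  rewrite exprS -[in X in X <= _]natr1.
  have h : 0 <= d%:R * x * x by rewrite !mulr_ge0.
  have x1' : 0 <= 1 - x by rewrite subr_ge0.
  by apply: le_trans (ler_wpM2l x1' ih); nra.
exists (Num.truncn (d1%:R * (2 * a)%:R / eta)).+1 => L hL.
have hL' : d1%:R * (2 * a)%:R / eta <= (2 * (L + a)).+1%:R :> R.
  apply: (@le_trans _ _ L%:R); last by rewrite ler_nat; lia.
  by rewrite ltW// (lt_le_trans (truncnS_gt _))// ler_nat.
pose s : R := (2 * (L + a)).+1%:R.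
have s0 : 0 < s by rewrite ltr0n.
pose x : R := (2 * a)%:R / s.
have x01 : 0 <= x <= 1.
  by rewrite /x divr_ge0 ?ler0n//= ler_pdivrMr// mul1r ler_nat; lia.
have hx : d1%:R * x <= eta.
  rewrite /x mulrA ler_pdivrMr// mulrC.
  by rewrite -ler_pdivrMl// [X in X <= _]mulrC [X in X / eta]mulrC.
have e : (2 * L).+1%:R = s * (1 - x).
  rewrite mulrBr mulr1 /x mulrCA divff ?lt0r_neq0// mulr1 /s -natrB; last by lia.
  by congr (_%:R); lia.
rewrite /cube_card !natrM mulrA ler_wpM2r ?ler0n// !natrX e exprMn mulrC.
rewrite -/s ler_wpM2l ?exprn_ge0 ?(ltW s0)//.
by apply: le_trans (bernoulli x d1 x01); rewrite lerD2l lerN2.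
Qed.

End Geometry.

(** * Counting localized families *)

Section Localization.
Context (R : realType) (d1 d2 : nat) (N : 'I_d2 -> nat).
Local Notation G := (fgab d1 N).
Local Notation origin := ([ffun=> 0] : {ffun 'I_d1 -> int}).
Local Open Scope ereal_scope.

Lemma esum_indic (T : choiceType) (A : set T) (b : T -> bool) :
  \esum_(i in A) ((b i)%:R : R)%:E = \esum_(i in A `&` [set i | b i]) (1 : \bar R).
Proof.
rewrite esum_mkcondr; apply: eq_esum => i _.
have -> : (i \in [set i | b i]) = b i by apply/idP/idP => [/set_mem|/mem_set].
by case: (b i).
Qed.

Section Tail.
Context (w : G -> R).
Hypothesis w_ge0 : forall n, (0 <= w n)%R.

Definition tail (L : nat) : \bar R := \esum_(n in ~` cube L origin) (w n)%:E.

(** The part of [w] outside a cube is extended by zero, so that its translates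
    can be summed over the whole group. *)
Definition far (L : nat) (n : G) : R := if n \in ~` cube L origin then w n else 0%R.

Lemma far_ge0 L n : (0 <= far L n)%R.
Proof. by rewrite /far; case: ifP. Qed.

Lemma tail_far L : tail L = \esum_(n in [set: G]) (far L n)%:E.
Proof.
by rewrite /tail esum_mkcond; apply: eq_esum => n _; rewrite /far; case: ifP.
Qed.

Lemma far_out L (n m : G) : ~ cube L m.1 n -> far L (fgab_sub n m) = w (fgab_sub n m).
Proof. by move=> h; rewrite /far mem_set//= => /cube_sub. Qed.

Lemma tail_ge0 L : 0 <= tail L.
Proof. by apply: esum_ge0 => n _; rewrite lee_fin. Qed.

Lemma tail_small (eta : R) : \esum_(n in [set: G]) (w n)%:E < +oo -> (0 < eta)%R ->
  exists L0, forall L, (L0 <= L)%N -> tail L <= eta%:E.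
Proof.
move=> woo eta0.
have w0 n : 0 <= (w n)%:E by rewrite lee_fin.
have [A hA] := esum_tail w0 woo eta0.
exists (\max_(n : A) \max_(i < d1) `|(val n).1 i|)%N => L hL.
apply: le_trans hA; apply: esum_subset => // n /= nL nA; apply: nL => i.
rewrite ffunE subr0; apply: leq_trans hL.
apply: leq_trans (leq_bigmax (F := fun m : A => \max_(i < d1) `|(val m).1 i|%N) [` nA]%fset).
exact: (leq_bigmax (F := fun i => `|n.1 i|%N) i).
Qed.

End Tail.

Lemma esum_shiftl (f : G -> \bar R) (m : G) :
  \esum_(n in [set: G]) f (fgab_sub n m) = \esum_(n in [set: G]) f n.
Proof. by rewrite -(reindex_esum setT setT _ f (fgab_subl_bij m)). Qed.

Lemma esum_shiftr (f : G -> \bar R) (n : G) :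
  \esum_(m in [set: G]) f (fgab_sub n m) = \esum_(m in [set: G]) f m.
Proof. by rewrite -(reindex_esum setT setT _ f (fgab_subr_bij n)). Qed.

Context (I : choiceType) (E : set I) (m : I -> G).

Section ColumnSum.
Context (C : R).
Hypothesis hC : forall p, \esum_(e in E `&` [set e | m e == p]) (1 : \bar R) <= C%:E.

Lemma multiplicity_ge0 : (0 <= C)%R.
Proof.
rewrite -lee_fin; apply: le_trans (hC (fgab0 d1 N)).
by apply: esum_ge0 => i _; rewrite lee_fin.
Qed.

(** Bounded multiplicity of the centres turns a sum over the family into a sum
    over the group. *)
Lemma esum_translates_le (f : G -> R) (n : G) : (forall p, 0 <= f p)%R ->
  \esum_(e in E) (f (fgab_sub n (m e)))%:E <= C%:E * \esum_(p in [set: G]) (f p)%:E.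
Proof.
move=> f0; rewrite -(esum_shiftr (fun p => (f p)%:E) n).
rewrite -esumZl ?multiplicity_ge0//; last by move=> p; rewrite lee_fin.
have -> : \esum_(e in E) (f (fgab_sub n (m e)))%:E =
    \esum_(e in E) \esum_(p in [set: G]) (f (fgab_sub n p) * (m e == p)%:R)%:E.
  apply: eq_esum => e _; rewrite (esumID [set m e])//; last first.
    by move=> p _; rewrite lee_fin mulr_ge0.
  rewrite !setTI esum_set1 ?lee_fin ?mulr_ge0// eqxx mulr1 esum1 ?adde0//.
  by move=> p /= /eqP; rewrite eq_sym => /negPf ->; rewrite mulr0.
rewrite esum_exchange; last by move=> e p _ _; rewrite lee_fin mulr_ge0.
apply: le_esum => p _; under eq_esum do rewrite EFinM.
rewrite esumZl//.
by rewrite esum_indic [X in X <= _]muleC lee_wpmul2r ?lee_fin.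
Qed.

End ColumnSum.

Section Concentration.
Context (q : I -> G -> \bar R) (w : G -> R).
Hypothesis q_ge0 : forall e n, 0 <= q e n.
Hypothesis w_ge0 : forall n, (0 <= w n)%R.
Hypothesis q_sum1 : forall e, E e -> \esum_(n in [set: G]) q e n = 1.
Hypothesis q_loc : forall e n, E e -> q e n <= (w (fgab_sub n (m e)))%:E.

Lemma mass_off_cube_le e L : E e -> \esum_(n in ~` cube L (m e).1) q e n <= tail w L.
Proof.
move=> Ee; rewrite tail_far -(esum_shiftl (fun n => (far w L n)%:E) (m e)).
apply: (@le_trans _ _ (\esum_(n in ~` cube L (m e).1) (far w L (fgab_sub n (m e)))%:E)).
  by apply: le_esum => n hn; rewrite far_out// q_loc.
by apply: esum_le_setT => n; rewrite lee_fin far_ge0.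
Qed.

Lemma mass_cube_le1 e A : E e -> \esum_(n in A) q e n <= 1.
Proof. by move=> Ee; rewrite -(q_sum1 Ee) esum_le_setT. Qed.

(** A member centred in a cube keeps all but the mass [t] of its unit mass inside
    the cube enlarged by [L]. *)
Lemma count_le_mass (J : set I) (A L : nat) k (t : R) : J `<=` E -> (t <= 1)%R ->
    tail w L <= t%:E ->
  ((1 - t)%:E * (\esum_(e in J `&` [set e | cube A k (m e)]) (1 : \bar R)) <=
   \esum_(e in J) \esum_(n in cube (A + L) k) q e n)%E.
Proof.
move=> JE t1 ht; rewrite -esum_cst ?subr_ge0//.
apply: (@le_trans _ _ (\esum_(e in J `&` [set e | cube A k (m e)])
    \esum_(n in cube (A + L) k) q e n)); last first.
  by apply: esum_subset => [e []|e _]//; exact: esum_ge0.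
apply: le_esum => e [/JE Ee /= ce].
have := q_sum1 Ee; rewrite (esumID (cube (A + L) k))// !setTI => h.
have off : \esum_(n in ~` cube (A + L) k) q e n <= t%:E.
  apply: le_trans ht; apply: le_trans (mass_off_cube_le L Ee).
  apply: esum_subset => // n /= h1 h2; apply: h1.
  by rewrite addnC; apply: cube_trans h2 _.
rewrite EFinB -h leeBlDr//.
by rewrite leeD2l.
Qed.

(** Members centred in the enlarged cube contribute at most one each.  The others
    are seen from a point of the cube only through the tail of [w], and bounded
    multiplicity of the centres controls their total. *)
Lemma mass_le_count (C : R) (J : set I) (A L : nat) k (t : R) :
    (forall p, \esum_(e in E `&` [set e | m e == p]) (1 : \bar R) <= C%:E) ->
    J `<=` E -> tail w L <= t%:E ->
  \esum_(e in J) \esum_(n in cube A k) q e n <=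
  \esum_(e in J `&` [set e | cube (A + L) k (m e)]) 1
    + (C * t * (cube_card d1 N A)%:R)%:E.
Proof.
move=> hC JE ht; rewrite (esumID [set e | cube (A + L) k (m e)]); last first.
  by move=> e _; exact: esum_ge0.
apply: leeD.
  by apply: le_esum => e [/JE Ee _]; exact: mass_cube_le1.
rewrite esum_exchange//.
apply: (@le_trans _ _ (\esum_(n in cube A k) (C * t)%:E)); last first.
  have Ct0 : (0 <= C * t)%R.
    by rewrite mulr_ge0 ?(multiplicity_ge0 hC)// -lee_fin (le_trans _ ht)// tail_ge0.
  by rewrite esum_cst// cube_esum1 -EFinM.
apply: le_esum => n hn.
apply: (@le_trans _ _ (\esum_(e in E) (far w L (fgab_sub n (m e)))%:E)).
  apply: (@le_trans _ _ (\esum_(e in J `&` ~` [set e | cube (A + L) k (m e)])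
      (far w L (fgab_sub n (m e)))%:E)).
    apply: le_esum => e [/JE Ee /= he]; rewrite far_out ?q_loc// => h; apply: he.
    by move=> i; rewrite addnC; apply: distz_trans (hn i); rewrite distzC; exact: h.
  apply: esum_subset => [e [/JE]//|e _]; by rewrite lee_fin far_ge0.
rewrite (le_trans (esum_translates_le hC _ _))//; first exact: far_ge0.
by rewrite -tail_far EFinM lee_wpmul2l// lee_fin (multiplicity_ge0 hC).
Qed.

End Concentration.

(** Double counting of the pairs (member, group element) that lie in a common
    tile. *)
Section Tiling.
Context (J : set I) (rho K : nat).
Hypothesis hK : forall t, \esum_(e in J `&` [set e | tile rho (m e) == t]) (1 : \bar R)
  = K%:R%:E.
Local Notation V := (cube_card d1 N rho).

Lemma same_tile_near (x y : G) (A : nat) k : tile rho x = tile rho y ->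
  cube A k x -> cube (A + 2 * rho) k y.
Proof.
move=> xy hx i.
have xc : cube rho (tile_center rho (tile rho x)) x by rewrite -tileE.
have yc : cube rho (tile_center rho (tile rho x)) y by rewrite -tileE /= xy.
rewrite addnC mul2n -addnn; apply: distz_trans (hx i); apply: distz_trans (yc i) _.
by rewrite distzC; exact: xc.
Qed.

Lemma tile_esum1 (x : G) (A : set G) :
  \esum_(n in A) ((tile rho x == tile rho n)%:R : R)%:E <= V%:R%:E.
Proof.
rewrite esum_indic -(cube_esum1 _ R rho (tile_center rho (tile rho x))).
by apply: esum_subset => // n [_ /= /eqP e]; rewrite -tileE.
Qed.

Lemma count_le_tiles A k :
  (V%:R%:E * (\esum_(e in J `&` [set e | cube A k (m e)]) (1 : \bar R)) <=
  (K * cube_card d1 N (A + 2 * rho))%:R%:E)%E.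
Proof.
rewrite -esum_cst//.
have -> : \esum_(e in J `&` [set e | cube A k (m e)]) V%:R%:E =
  \esum_(e in J `&` [set e | cube A k (m e)]) \esum_(n in (cube (A + 2 * rho) k : set G))
    ((tile rho (m e) == tile rho n)%:R : R)%:E.
  apply: eq_esum => e [_ /= ce]; rewrite esum_indic.
  rewrite -(cube_esum1 _ R rho (tile_center rho (tile rho (m e)))) -tileE.
  congr esum; apply/seteqP; split => [n /= h|n [_ /= /eqP ->]//].
  by split; rewrite /= ?h//; apply: same_tile_near ce.
rewrite esum_exchange; last by move=> *; rewrite lee_fin.
rewrite natrM EFinM -(cube_esum1 _ R _ k) -esum_cst//.
apply: le_esum => n _; rewrite esum_indic -(hK (tile rho n)).
by apply: esum_subset => // e [[Je _] /= h].
Qed.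

Lemma tiles_le_count A k :
  ((K * cube_card d1 N A)%:R%:E <=
  V%:R%:E * (\esum_(e in J `&` [set e | cube (A + 2 * rho) k (m e)]) (1 : \bar R)))%E.
Proof.
rewrite -esum_cst// natrM EFinM -(cube_esum1 _ R _ k) -esum_cst//.
apply: (@le_trans _ _ (\esum_(n in (cube A k : set G))
    \esum_(e in J `&` [set e | cube (A + 2 * rho) k (m e)])
    ((tile rho (m e) == tile rho n)%:R : R)%:E)).
  apply: le_esum => n hn; rewrite esum_indic -(hK (tile rho n)).
  apply: esum_subset => // e [Je /= /eqP h]; split; rewrite /= ?h ?eqxx//.
  by split => //; apply: same_tile_near hn.
rewrite esum_exchange; last by move=> *; rewrite lee_fin.
by apply: le_esum => e _; exact: tile_esum1.
Qed.

End Tiling.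

End Localization.

(** * Densities *)

Section PositiveFactor.
Context (R : realType) (v : R).
Hypothesis v_gt0 : 0 < v.
Local Open Scope ereal_scope.

Lemma lee_div_mul (c : \bar R) (r : R) : v%:E * c <= r%:E -> c <= (r / v)%:E.
Proof.
case: c => [c||]; last by rewrite leNye.
  by rewrite -EFinM lee_fin lee_fin ler_pdivlMr// mulrC.
by rewrite mulry gtr0_sg// mul1e.
Qed.

Lemma lee_mul_div (c : \bar R) (r : R) : r%:E <= v%:E * c -> (r / v)%:E <= c.
Proof.
case: c => [c||]; first by rewrite -EFinM lee_fin lee_fin ler_pdivrMr// mulrC.
  by rewrite leey.
by rewrite mulrNy gtr0_sg// mul1e.
Qed.

End PositiveFactor.

Section TiledAsymptotics.
Context (R : realType) (d1 d2 : nat) (N : 'I_d2 -> nat).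
Local Notation G := (fgab d1 N).
Context (I : choiceType) (E : set I) (m : I -> G) (q : I -> G -> \bar R) (w : G -> R).
Hypothesis q_ge0 : forall e n, (0 <= q e n)%E.
Hypothesis w_ge0 : forall n, 0 <= w n.
Hypothesis q_sum1 : forall e, E e -> (\esum_(n in [set: G]) q e n = 1)%E.
Hypothesis q_loc : forall e n, E e -> (q e n <= (w (fgab_sub n (m e)))%:E)%E.
Hypothesis w_sum : (\esum_(n in [set: G]) (w n)%:E < +oo)%E.
Context (C : R).
Hypothesis hC : forall p, (\esum_(e in E `&` [set e | m e == p]) (1 : \bar R) <= C%:E)%E.
Context (J : set I) (rho K : nat).
Hypothesis JE : J `<=` E.
Hypothesis hK : forall t, (\esum_(e in J `&` [set e | tile rho (m e) == t]) (1 : \bar R)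
  = K%:R%:E)%E.

(** The number of members whose centre lies in a cube is asymptotically [K] per
    tile, and localization makes the mass in the cube the same to first order. *)
Lemma tiled_mass_asymptotics (eta : R) : 0 < eta ->
  exists A0 : nat, forall A k, (A0 <= A)%N ->
    (((K%:R / (cube_card d1 N rho)%:R - eta) * (cube_card d1 N A)%:R)%:E <=
       \esum_(e in J) \esum_(n in (cube A k : set G)) q e n <=
     ((K%:R / (cube_card d1 N rho)%:R + eta) * (cube_card d1 N A)%:R)%:E)%E.
Proof.
move=> eta0; set V := cube_card d1 N rho.
have V0 : 0 < V%:R :> R by rewrite ltr0n cube_card_gt0.
pose X : R := K%:R / V%:R; rewrite -/X.
have X0 : 0 <= X by rewrite divr_ge0.
have C0 := multiplicity_ge0 hC.
(* With relative boundary errors [t], the count per volume lies between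
   [X * (1 - t) ^+ 2] and [X / (1 - t) <= X * (1 + 2 * t)], and the tails add
   at most [C * t]; the total error is below [t * D]. *)
pose D := 2 * X + C + 1.
have D0 : 0 < D by rewrite /D; lra.
pose t := Num.min 2^-1 (eta / D).
have t0 : 0 < t by rewrite lt_min invr_gt0 ltr0n divr_gt0.
have t12 : t <= 2^-1 by rewrite ge_min lexx.
have t1 : t <= 1 by lra.
have tD : t * D <= eta by rewrite -ler_pdivlMr// ge_min lexx orbT.
have [L0 hL] := tail_small w_ge0 w_sum t0.
have {hL} hL := hL L0 (leqnn _).
pose S := (L0 + 2 * rho)%N.
have [A1 hA1] := cube_card_ratio d1 N S t0.
exists (A1 + S)%N => A k hA.
have hSA : (S <= A)%N := leq_trans (leq_addl _ _) hA.
have hAS : (A1 <= A - S)%N by rewrite leq_subRL// addnC.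
have hA1A : (A1 <= A)%N := leq_trans (leq_addr _ _) hA.
have eA : A = ((A - S + 2 * rho) + L0)%N.
  by rewrite -addnA [X in (_ + X)%N]addnC subnK.
set a : R := (cube_card d1 N A)%:R.
have a0 : 0 <= a by exact: ler0n.
apply/andP; split.
- have /(lee_mul_div V0) := tiles_le_count hK (A - S)%N k.
  rewrite natrM; set b : R := (cube_card d1 N (A - S))%:R => hb.
  have hab : (1 - t) * a <= b.
    by have := hA1 _ hAS; rewrite subnK.
  rewrite [in X in (_ <= X)%E]eA.
  apply: le_trans (count_le_mass q_ge0 w_ge0 q_sum1 q_loc _ k JE t1 hL).
  apply: (@le_trans _ _ ((1 - t)%:E * (K%:R * b / V%:R)%:E)%E); last first.
    by rewrite lee_wpmul2l// lee_fin subr_ge0.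
  rewrite -EFinM lee_fin mulrAC -/X.
  have h1 : X * ((1 - t) * a) <= X * b by rewrite ler_wpM2l.
  have h2 : (1 - t) * (X * ((1 - t) * a)) <= (1 - t) * (X * b).
    by rewrite ler_wpM2l// subr_ge0.
  apply: le_trans h2.
  rewrite (_ : (1 - t) * (X * ((1 - t) * a)) = X * (1 - t) ^+ 2 * a); last by ring.
  rewrite ler_wpM2r//.
  have : X * (2 * t) <= eta.
    by apply: le_trans tD; rewrite /D; nra.
  by have := sqr_ge0 t; nra.
- have /(lee_div_mul V0) := count_le_tiles hK (A + L0)%N k.
  rewrite natrM -addnA -/S; set b : R := (cube_card d1 N (A + S))%:R => hb.
  have hab : (1 - t) * b <= a by exact: hA1.
  apply: le_trans (mass_le_count q_ge0 w_ge0 q_sum1 q_loc A k hC JE hL) _.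
  apply: (@le_trans _ _ ((K%:R * b / V%:R)%:E + (C * t * a)%:E)%E).
    by rewrite leeD2r.
  rewrite -EFinD lee_fin mulrAC -/X.
  have b2 : b <= (1 + 2 * t) * a.
    have b0 : 0 <= b by exact: ler0n.
    have t2 : 0 <= 1 + 2 * t by lra.
    have tt : 0 <= t * (1 - 2 * t) by rewrite mulr_ge0//; lra.
    have := mulr_ge0 tt b0; have := ler_wpM2l t2 hab; lra.
  have h1 : X * b <= X * ((1 + 2 * t) * a) by rewrite ler_wpM2l.
  have : (X * (2 * t) + C * t) * a <= eta * a.
    by rewrite ler_wpM2r//; apply: le_trans tD; rewrite /D; lra.
  lra.
Qed.

End TiledAsymptotics.

Section LimitsAtInfinity.
Context (R : realType) (F : R -> \bar R).
Local Open Scope ereal_scope.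

Lemma limf_esup_pinfty_lt a : limf_esup F +oo%R < a ->
  exists M : R, forall r, (M < r)%R -> F r < a.
Proof.
rewrite limf_esupE => /ereal_inf_lt[_ [V [M [_ MV]] <-] Va].
exists M => r Mr; apply: le_lt_trans Va; apply: ereal_sup_ubound.
by exists r => //; exact: MV.
Qed.

Lemma limf_esup_pinfty_le a (M : R) : (forall r, (M < r)%R -> F r <= a) ->
  limf_esup F +oo%R <= a.
Proof.
move=> h; rewrite limf_esupE.
apply: (@le_trans _ _ (ereal_sup (F @` [set r | (M < r)%R]))).
  apply: ereal_inf_lbound; exists [set r | (M < r)%R] => //.
  by exists M; split => //; exact: num_real.
by apply: ge_ereal_sup => _ [r Mr <-]; exact: h.
Qed.

End LimitsAtInfinity.

Section LowerLimitsAtInfinity.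
Context (R : realType) (F : R -> \bar R).
Local Open Scope ereal_scope.

Lemma limf_einf_pinfty_gt a : a < limf_einf F +oo%R ->
  exists M : R, forall r, (M < r)%R -> a < F r.
Proof.
rewrite /limf_einf lteNr => /limf_esup_pinfty_lt[M h].
by exists M => r /h; rewrite lteNl oppeK.
Qed.

Lemma limf_einf_pinfty_ge a (M : R) : (forall r, (M < r)%R -> a <= F r) ->
  a <= limf_einf F +oo%R.
Proof.
move=> h; rewrite /limf_einf leeNr; apply: (@limf_esup_pinfty_le _ _ _ M) => r /h.
by rewrite leeN2.
Qed.

End LowerLimitsAtInfinity.

Section Densities.
Context (R : realType) (k : scalar_kind).
Local Notation K := (scalar_field R k).
Context (H : completeNormedModType K) (ip : {dot H for @scalar_conj R k}).
Hypothesis hH : hilbert_norm ip.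
Context (d1 d2 : nat) (N : 'I_d2 -> nat).
Local Notation G := (fgab d1 N).
Context (g : G -> H).
Hypothesis hg : orthonormal_basis ip setT g.
Context (I : choiceType) (E : set I) (f : I -> H).
Hypothesis nE : forall e, E e -> nrm (f e) = 1.

Definition coef_mass (e : I) (n : G) : \bar R := (nrm (ip (f e) (g n)) ^+ 2)%:E.

Lemma coef_mass_ge0 e n : (0 <= coef_mass e n)%E.
Proof. by rewrite lee_fin sqr_ge0. Qed.

Lemma coef_mass_sum1 e : E e -> (\esum_(n in [set: G]) coef_mass e n = 1)%E.
Proof. by move=> /nE e1; rewrite /coef_mass (parseval hH hg) e1 expr1n. Qed.

Lemma coef_le1 e n : E e -> nrm (ip (f e) (g n)) <= 1.
Proof.
move=> /nE e1; rewrite (le_trans (cauchy_schwarz hH _ _))// e1 mul1r.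
by rewrite (orthonormal_nrm hH hg.1).
Qed.

Lemma local_densityE (J : set I) (r : R) (p : G) : J `<=` E ->
    (fin_part_diam N)%:R <= r ->
  local_density ip g J f r p =
  ((\esum_(e in J) \esum_(n in (cube (Num.truncn r) p.1 : set G)) coef_mass e n) *
   ((cube_card d1 N (Num.truncn r))%:R^-1)%:E)%E.
Proof.
move=> JE hr; rewrite /local_density !fgab_ball_cube//; congr (_ * _)%E.
  apply: eq_esum => e /JE Ee; rewrite /weight (coef_mass_sum1 Ee).
  by rewrite /= invr1 mul1e.
congr ((_^-1)%:E); have := @cube_esum1 d1 d2 N R (Num.truncn r) (fgab0 d1 N).1.
by rewrite esum1_card; [case|exact: cube_finite].
Qed.

Lemma local_density_lower (J : set I) (x : R) : J `<=` E ->
    (x%:E < lower_density ip g J f)%E ->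
  exists A0 : nat, forall A p, (A0 <= A)%N ->
    ((x * (cube_card d1 N A)%:R)%:E <=
      \esum_(e in J) \esum_(n in (cube A p : set G)) coef_mass e n)%E.
Proof.
move=> JE /limf_einf_pinfty_gt[M hM].
exists (fin_part_diam N + (Num.truncn M).+1)%N => A p hA.
have MA : M < A%:R.
  by rewrite (lt_le_trans (truncnS_gt _))// ler_nat (leq_trans (leq_addl _ _) hA).
have dA : (fin_part_diam N)%:R <= A%:R :> R by rewrite ler_nat (leq_trans (leq_addr _ _) hA).
have := hM _ MA => /ltW h.
pose pt : G := (p, (fgab0 d1 N).2).
have rpt : range (local_density ip g J f A%:R) (local_density ip g J f A%:R pt).
  by exists pt.
have {h} := le_trans h (ereal_inf_lbound rpt).
rewrite local_densityE// natrK /=.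
have c0 : 0 < (cube_card d1 N A)%:R :> R by rewrite ltr0n cube_card_gt0.
by rewrite lee_pdivlMr.
Qed.

Lemma local_density_upper (J : set I) : J `<=` E ->
    (upper_density ip g J f < +oo)%E ->
  exists x : R, exists A0 : nat, forall A p, (A0 <= A)%N ->
    (\esum_(e in J) \esum_(n in (cube A p : set G)) coef_mass e n <=
     (x * (cube_card d1 N A)%:R)%:E)%E.
Proof.
move=> JE hu.
have [x hx] : exists x : R, (upper_density ip g J f < x%:E)%E.
  move: hu; case: (upper_density _ _ _ _) => [y||] // _.
    by exists (y + 1); rewrite lte_fin ltrDl.
  by exists 0; rewrite ltNyr.
move: hx => /limf_esup_pinfty_lt[M hM]; exists x.
exists (fin_part_diam N + (Num.truncn M).+1)%N => A p hA.
have MA : M < A%:R.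
  by rewrite (lt_le_trans (truncnS_gt _))// ler_nat (leq_trans (leq_addl _ _) hA).
have dA : (fin_part_diam N)%:R <= A%:R :> R by rewrite ler_nat (leq_trans (leq_addr _ _) hA).
have := hM _ MA => /ltW h.
pose pt : G := (p, (fgab0 d1 N).2).
have rpt : range (local_density ip g J f A%:R) (local_density ip g J f A%:R pt).
  by exists pt.
have {h} := le_trans (ereal_sup_ubound rpt) h.
rewrite local_densityE// natrK /=.
have c0 : 0 < (cube_card d1 N A)%:R :> R by rewrite ltr0n cube_card_gt0.
by rewrite lee_pdivrMr.
Qed.

Lemma density_of_asymptotics (J : set I) (X : R) : J `<=` E ->
    (forall eta : R, 0 < eta -> exists A0 : nat, forall A p, (A0 <= A)%N ->
      (((X - eta) * (cube_card d1 N A)%:R)%:E <=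
         \esum_(e in J) \esum_(n in (cube A p : set G)) coef_mass e n <=
       ((X + eta) * (cube_card d1 N A)%:R)%:E)%E) ->
  lower_density ip g J f = X%:E /\ upper_density ip g J f = X%:E.
Proof.
move=> JE asymp.
have bound (eta : R) : 0 < eta -> exists M : R, forall r p, M < r ->
    ((X - eta)%:E <= local_density ip g J f r p <= (X + eta)%:E)%E.
  move=> /asymp[A0 hA]; exists (fin_part_diam N + A0)%:R => r p Mr.
  have r0 : 0 <= r by rewrite ltW// (le_lt_trans _ Mr).
  have Ar : (A0 <= Num.truncn r)%N.
    by rewrite truncn_ge_nat// ltW// (le_lt_trans _ Mr)// ler_nat leq_addl.
  rewrite local_densityE//; last by rewrite ltW// (le_lt_trans _ Mr)// ler_nat leq_addr.
  have c0 : 0 < (cube_card d1 N (Num.truncn r))%:R :> R.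
    by rewrite ltr0n cube_card_gt0.
  by rewrite lee_pdivlMr// lee_pdivrMr//; exact: hA.
have lo : (X%:E <= lower_density ip g J f)%E.
  apply/lee_addgt0Pr => eta /bound[M hM].
  rewrite -leeBlDr// -EFinB; apply: (@limf_einf_pinfty_ge _ _ _ M) => r Mr.
  by apply: le_ereal_inf_tmp => _ [p _ <-]; case/andP: (hM r p Mr).
have up : (upper_density ip g J f <= X%:E)%E.
  apply/lee_addgt0Pr => eta /bound[M hM].
  rewrite -EFinD; apply: (@limf_esup_pinfty_le _ _ _ M) => r Mr.
  by apply: ge_ereal_sup => _ [p _ <-]; case/andP: (hM r p Mr).
have lo' : (lower_density ip g J f <= X%:E)%E.
  apply/lee_addgt0Pr => eta /bound[M hM]; rewrite leNgt; apply/negP.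
  move=> /limf_einf_pinfty_gt[M' hM'].
  pose r := Num.max M M' + 1.
  have Mr : M < r by rewrite ltr_pwDr// le_max lexx.
  have M'r : M' < r by rewrite ltr_pwDr// le_max lexx orbT.
  have := hM' r M'r; apply/negP; rewrite -leNgt -EFinD.
  apply: le_trans (ereal_inf_lbound _) (proj2 (andP (hM r (fgab0 d1 N) Mr))).
  by exists (fgab0 d1 N).
have up' : (X%:E <= upper_density ip g J f)%E.
  apply/lee_addgt0Pr => eta /bound[M hM]; rewrite -leeBlDr// leNgt; apply/negP.
  move=> /limf_esup_pinfty_lt[M' hM'].
  pose r := Num.max M M' + 1.
  have Mr : M < r by rewrite ltr_pwDr// le_max lexx.
  have M'r : M' < r by rewrite ltr_pwDr// le_max lexx orbT.
  have := hM' r M'r; apply/negP; rewrite -leNgt -EFinB.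
  apply: le_trans (proj1 (andP (hM r (fgab0 d1 N) Mr))) (ereal_sup_ubound _).
  by exists (fgab0 d1 N).
by split; apply/eqP; rewrite eq_le ?lo ?up ?lo' ?up'.
Qed.

End Densities.

(** * Almost orthogonality and Riesz sequences *)

Section GramEstimate.
Context (R : realType) (k : scalar_kind).
Local Notation K := (scalar_field R k).
Local Notation re := (@scalar_re R k).
Context (H : completeNormedModType K) (ip : {dot H for @scalar_conj R k}).
Hypothesis hH : hilbert_norm ip.
Context (I : choiceType).

Lemma nrm_sqr_sum (s : seq I) (P : pred I) (x : I -> H) :
  nrm (\sum_(i <- s | P i) x i) ^+ 2 =
  \sum_(i <- s | P i) \sum_(j <- s | P j) re (ip (x i) (x j)).
Proof.
rewrite (nrm_sqr hH) ip_suml scalar_re_sum; apply: eq_bigr => i _.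
by rewrite ip_sumr scalar_re_sum.
Qed.

(** A block version of diagonal dominance: lower bounds inside the classes of
    [tau] survive up to the largest row sum of the Gram matrix across classes. *)
Lemma nrm_sqr_sum_blocks (Q : choiceType) (tau : I -> Q) (f : I -> H) (a : I -> K)
    (F : {fset I}) (c theta : R) :
  (forall t, c * \sum_(i <- F | tau i == t) nrm (a i) ^+ 2 <=
     nrm (\sum_(i <- F | tau i == t) a i *: f i) ^+ 2) ->
  (forall i, i \in F -> \sum_(j <- F | tau j != tau i) nrm (ip (f i) (f j)) <= theta) ->
  (c - theta) * \sum_(i <- F) nrm (a i) ^+ 2 <= nrm (\sum_(i <- F) a i *: f i) ^+ 2.
Proof.
move=> hc htheta.
pose x i := a i *: f i.
pose gram i j := nrm (ip (f i) (f j)).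
have gramC i j : gram i j = gram j i by rewrite /gram (ipC ip (f j)) nrm_conj.
have gram_ge0 i j : 0 <= gram i j by exact: nrm_ge0.
pose diag := \sum_(i <- F) \sum_(j <- F | tau j == tau i) re (ip (x i) (x j)).
pose off := \sum_(i <- F) \sum_(j <- F | tau j != tau i) re (ip (x i) (x j)).
have -> : nrm (\sum_(i <- F) a i *: f i) ^+ 2 = diag + off.
  rewrite nrm_sqr_sum -big_split; apply: eq_bigr => i _ /=.
  by rewrite (bigID (fun j => tau j == tau i)).
have diag_ge : c * \sum_(i <- F) nrm (a i) ^+ 2 <= diag.
  rewrite /diag (partition_big_imfset _ tau) /= [in leRHS](partition_big_imfset _ tau) /=.
  rewrite mulr_sumr; apply: ler_sum => t _; apply: le_trans (hc t) _.
  rewrite nrm_sqr_sum le_eqVlt; apply/orP; left; apply/eqP.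
  by apply: eq_bigr => i /eqP ->.
have off_ge : - (theta * \sum_(i <- F) nrm (a i) ^+ 2) <= off.
  pose M := \sum_(i <- F) \sum_(j <- F | tau j != tau i) nrm (a i) ^+ 2 * gram i j.
  have M_le : M <= theta * \sum_(i <- F) nrm (a i) ^+ 2.
    rewrite mulr_sumr /M big_seq [in leRHS]big_seq; apply: ler_sum => i iF.
    by rewrite -mulr_sumr mulrC ler_wpM2r ?sqr_ge0//; exact: htheta.
  have M_sym : M = \sum_(i <- F) \sum_(j <- F | tau j != tau i) nrm (a j) ^+ 2 * gram i j.
    rewrite /M (exchange_big_dep xpredT)//=; apply: eq_bigr => j _.
    rewrite [LHS]big_mkcond [RHS]big_mkcond /=; apply: eq_bigr => i _.
    by rewrite eq_sym gramC.
  rewrite lerNl; apply: le_trans M_le.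
  suff : 2 * - off <= M + \sum_(i <- F) \sum_(j <- F | tau j != tau i) nrm (a j) ^+ 2 * gram i j.
    by rewrite -M_sym; lra.
  rewrite /off /M -big_split /= -sumrN mulr_sumr; apply: ler_sum => i _.
  rewrite -big_split /= -sumrN mulr_sumr; apply: ler_sum => j _.
  have h : - re (ip (x i) (x j)) <= nrm (a i) * nrm (a j) * gram i j.
    rewrite -scalar_reN (le_trans (scalar_re_le_nrm _))// nrmN /x ipZl ipZr.
    by rewrite !nrmM nrm_conj mulrA.
  have := sqr_ge0 (nrm (a i) - nrm (a j)).
  have := gram_ge0 i j; nra.
lra.
Qed.

End GramEstimate.

Section GramDecay.
Context (R : realType) (k : scalar_kind).
Local Notation K := (scalar_field R k).
Context (H : completeNormedModType K) (ip : {dot H for @scalar_conj R k}).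
Hypothesis hH : hilbert_norm ip.
Context (d1 d2 : nat) (N : 'I_d2 -> nat).
Local Notation G := (fgab d1 N).
Context (g : G -> H).
Hypothesis hg : orthonormal_basis ip setT g.
Context (I : choiceType) (E : set I) (f : I -> H) (m : I -> G) (w : G -> R).
Hypothesis w_ge0 : forall n, 0 <= w n.
Hypothesis f_loc : forall e n, E e -> nrm (ip (f e) (g n)) <= w (fgab_sub n (m e)).
Context (C W t : R) (L : nat).
Hypothesis hC : forall p, (\esum_(e in E `&` [set e | m e == p]) (1 : \bar R) <= C%:E)%E.
Hypothesis hW : (\esum_(n in [set: G]) (w n)%:E <= W%:E)%E.
Hypothesis ht : (tail w L <= t%:E)%E.
Local Open Scope ereal_scope.

(** Two members with distant centres have, at every point of the group, at
    least one coefficient in the tail. *)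
Lemma gram_row_far_le e (S : set I) : E e -> S `<=` E ->
    (forall e', S e' -> ~ cube (2 * L) (m e).1 (m e')) ->
  \esum_(e' in S) (nrm (ip (f e) (f e')))%:E <= (2 * C * W * t)%:E.
Proof.
move=> Ee SE hS.
have C0 := multiplicity_ge0 hC.
pose b n e' := (far w L (fgab_sub n (m e)) * w (fgab_sub n (m e'))
  + w (fgab_sub n (m e)) * far w L (fgab_sub n (m e')))%R.
have far0 n : (0 <= far w L n)%R by exact: far_ge0.
have b0 n e' : 0 <= (b n e')%:E by rewrite lee_fin addr_ge0// mulr_ge0.
apply: (@le_trans _ _ (\esum_(e' in S) \esum_(n in [set: G]) (b n e')%:E)).
  apply: le_esum => e' Se'; apply: le_trans (nrm_ip_le_esum hH hg _ _) _.
  apply: le_esum => n _; rewrite lee_fin.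
  apply: (@le_trans _ _ (w (fgab_sub n (m e)) * w (fgab_sub n (m e')))%R).
    by rewrite ler_pM ?nrm_ge0// f_loc//; exact: SE.
  rewrite /b; have [h|h] := pselect (cube L (m e).1 n).
    rewrite [X in (_ <= _ + _ * X)%R]far_out ?lerDr ?mulr_ge0// => h'.
    apply: (hS _ Se') => i; rewrite mul2n -addnn.
    by apply: distz_trans (h i); rewrite distzC; exact: h'.
  by rewrite (far_out _ h) lerDl mulr_ge0.
rewrite esum_exchange//.
have W0 : (0 <= W)%R.
  by rewrite -lee_fin (le_trans _ hW)//; apply: esum_ge0 => n _; rewrite lee_fin.
apply: (@le_trans _ _ (\esum_(n in [set: G])
    ((C * W)%:E * (far w L (fgab_sub n (m e)))%:E
     + (C * t)%:E * (w (fgab_sub n (m e)))%:E))).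
  apply: le_esum => n _.
  apply: (@le_trans _ _ (\esum_(e' in E) (b n e')%:E)); first exact: esum_subset.
  under eq_esum do rewrite /b EFinD !EFinM.
  rewrite esumD; last 2 first.
  - by move=> e' _; rewrite -EFinM lee_fin mulr_ge0.
  - by move=> e' _; rewrite -EFinM lee_fin mulr_ge0.
  rewrite !esumZl//; [|by move=> i; rewrite lee_fin..].
  have hw' : \esum_(e' in E) (w (fgab_sub n (m e')))%:E <= (C * W)%:E.
    apply: le_trans (esum_translates_le hC n w_ge0) _.
    by rewrite EFinM lee_wpmul2l// lee_fin.
  have hf' : \esum_(e' in E) (far w L (fgab_sub n (m e')))%:E <= (C * t)%:E.
    apply: le_trans (esum_translates_le hC n far0) _.
    by rewrite -tail_far EFinM lee_wpmul2l// lee_fin.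
  rewrite leeD//; rewrite muleC lee_wpmul2r ?lee_fin//.
have t0 : (0 <= t)%R by rewrite -lee_fin (le_trans _ ht)// tail_ge0.
rewrite esumD; last 2 first.
- by move=> n _; rewrite -EFinM lee_fin !mulr_ge0.
- by move=> n _; rewrite -EFinM lee_fin !mulr_ge0.
rewrite !esumZl ?mulr_ge0//; [|by move=> n; rewrite lee_fin..].
rewrite (esum_shiftl (fun n => (far w L n)%:E)) (esum_shiftl (fun n => (w n)%:E)).
rewrite -tail_far.
have -> : (2 * C * W * t)%R = (C * W * t + C * t * W)%R by ring.
rewrite EFinD; apply: leeD; rewrite [X in _ <= X]EFinM lee_wpmul2l// lee_fin mulr_ge0//.
Qed.

End GramDecay.

Section RieszLimit.
Context (R : realType) (k : scalar_kind).
Local Notation K := (scalar_field R k).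
Context (H : completeNormedModType K) (ip : {dot H for @scalar_conj R k}).
Hypothesis hH : hilbert_norm ip.
Context (E : set H) (T : {linear H -> H}).
Hypothesis oE : forall e f, E e -> E f -> ip e f = (e == f)%:R.
Hypothesis hT : bounded_operator T.
Local Notation opT := (opnorm (@nrm R k H) T).

Lemma nrm_sqr_image_le (s : seq H) (a : H -> K) : uniq s -> {in s, forall e, E e} ->
  nrm (\sum_(e <- s) a e *: T e) ^+ 2 <= opT ^+ 2 * \sum_(e <- s) nrm (a e) ^+ 2.
Proof.
move=> us sE.
rewrite -(@orthonormal_nrm_sum R k H ip hH H E id oE s a us sE) -exprMn.
rewrite (eq_bigr (fun e => T (a e *: e))) => [|e _]; last by rewrite linearZ.
rewrite -linear_sum lerXn2r// ?nnegrE ?nrm_ge0//.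
  by rewrite mulr_ge0 ?nrm_ge0// opnorm_ge0.
exact: nrm_le_opnorm.
Qed.

(** Images of orthonormal vectors satisfy the upper bound on finite sums, so the
    finite partial sums form a Cauchy net, and both bounds pass to its limit.
    Hence only finitely supported coefficients are left to check. *)
Lemma riesz_sequence_finite (J : set H) (A : R) : J `<=` E -> 0 < A -> A <= opT ^+ 2 ->
    (forall (F : {fset H}) (a : H -> K), [set` F] `<=` J ->
      A * \sum_(e <- F) nrm (a e) ^+ 2 <= nrm (\sum_(e <- F) a e *: T e) ^+ 2) ->
  riesz_sequence J T A (opT ^+ 2).
Proof.
move=> JE A0 AB lower; split => // a aoo.
set y := partial_sum _.
set S := esum _ _ in aoo *.
pose sq e : \bar R := (nrm (a e) ^+ 2)%:E.
have sq0 e : (0 <= sq e)%E by rewrite lee_fin sqr_ge0.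
have S0 : (0 <= S)%E by apply: esum_ge0 => e _; exact: sq0.
have finS : S \is a fin_num by rewrite ge0_fin_numE.
have op0 := opnorm_ge0 hT.
have op2 : 0 <= opT ^+ 2 by exact: sqr_ge0.
pose b e : \bar R := if e \in J then sq e else 0%E.
have b0 e : (0 <= b e)%E by rewrite /b; case: ifP.
have SE : S = (\esum_(e in [set: H]) b e)%E by exact: esum_mkcond.
have b_oo : (\esum_(e in [set: H]) b e < +oo)%E by rewrite -SE.
pose FJ (X : {fset H}) := [fset e in X | e \in J]%fset.
have FJ_J X : [set` FJ X] `<=` J.
  by move=> e /=; rewrite !inE => /andP[_ /set_mem].
pose N2 (X : {fset H}) := \sum_(e <- FJ X) nrm (a e) ^+ 2.
have N2E X : (N2 X)%:E = (\esum_(e in [set` X]) b e)%E.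
  rewrite esum_fset//.
  rewrite fsbig_finite//= set_fsetK /b -big_mkcond /= -sumEFin /FJ.
  by rewrite -big_fset_condE.
have yE (X : {fset H}) : y X = \sum_(e <- FJ X) a e *: T e.
  rewrite /y /partial_sum.
  rewrite -(big_seq_fsetE _ _ xpredT (patch (cst 0) J (fun i => a i *: T i))) /=.
  rewrite /FJ -big_fset_condE /= [RHS]big_mkcond /=.
  by apply: eq_bigr => e _; rewrite /patch; case: ifP.
have y_up X : nrm (y X) ^+ 2 <= opT ^+ 2 * N2 X.
  rewrite yE; apply: nrm_sqr_image_le; first exact: fset_uniq.
  by move=> e /(FJ_J X)/JE.
have y_lo X : A * N2 X <= nrm (y X) ^+ 2 by rewrite yE; apply: lower; exact: FJ_J.
have N2_le X : N2 X <= fine S.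
  by rewrite -lee_fin N2E fineK// SE esum_le_setT.
have ysplit (X Y : {fset H}) : (X `<=` Y)%fset ->
    y Y = y X + y [fset e in Y | e \notin X]%fset.
  move=> XY; rewrite /y /partial_sum.
  rewrite -!(big_seq_fsetE _ _ xpredT (patch (cst 0) J (fun i => a i *: T i))) /=.
  rewrite (big_fsetID _ (mem X)) /=; congr (_ + _).
  congr (\sum_(i <- _) _); congr (enum_fset _); apply/fsetP => e; rewrite !inE.
  by apply/andP/idP => [[]//|eX]; split => //; apply: (fsubsetP XY).
have tails (eta : R) : 0 < eta -> exists X : {fset H}, forall Y, (X `<=` Y)%fset ->
    N2 [fset e in Y | e \notin X]%fset <= eta /\ fine S <= N2 Y + eta.
  move=> /(esum_tail b0 b_oo)[X hX]; exists X => Y XY; split.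
    rewrite -lee_fin N2E (le_trans _ hX)//; apply: esum_subset => // e /=.
    by rewrite !inE => /andP[_ /negP].
  rewrite -lee_fin EFinD N2E fineK// SE (esumID [set` Y])// !setTI leeD2l//.
  apply: le_trans hX; apply: esum_subset => // e /= nY eX; apply: nY.
  exact: (fsubsetP XY).
have Ftot : ProperFilter (@totally H) by exact: totally_filter.
have Ffil : Filter (@totally H) by typeclasses eauto.
have above (X : {fset H}) : (@totally H) [set Y | (X `<=` Y)%fset] by exists X.
have ycauchy : cauchy (y @ (@totally H)).
  apply: cauchy_exP => e e0; have re0 : 0 < scalar_re e.
    by have := norm_lt_scalar (0 : H) (ltW e0); rewrite normr0 e0 nrm0.
  have oD : 0 < opT ^+ 2 + 1 by rewrite ltr_wpDl.
  have [X hX] := tails _ (divr_gt0 (exprn_gt0 2 re0) oD).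
  exists (y X); apply: filterS (above X) => Y /= XY.
  rewrite -ball_normE /= norm_lt_scalar ?ltW// -nrmN opprB (ysplit _ _ XY) addrAC subrr add0r.
  rewrite -(@ltr_pXn2r _ 2)// ?nnegrE ?nrm_ge0// ?ltW//.
  apply: le_lt_trans (y_up _) _; apply: le_lt_trans (ler_wpM2l op2 (hX _ XY).1) _.
  by rewrite mulrCA gtr_pMr ?exprn_gt0// ltr_pdivrMr// mul1r ltrDl.
have /cauchy_cvgP/cvg_ex[s ys] := ycauchy.
exists s => //.
have nys : (fun X => nrm (y X) ^+ 2) @ (@totally H) --> nrm s ^+ 2.
  have : (fun X => nrm (y X)) @ (@totally H) --> nrm s.
    apply/cvgrPdist_lt => e e0.
    have [z z0 ze] := exists_scalar_of_real k (ltW e0).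
    have z_gt0 : 0 < z.
      by rewrite -(normr0 H) norm_lt_scalar// nrm0 ze.
    have hz := (@cvgrPdist_lt _ _ _ _ Ffil y s).1 ys z z_gt0.
    apply: (filterS _ hz) => X; rewrite norm_lt_scalar// ze => h; apply: le_lt_trans h.
    rewrite ler_norml; apply/andP; split.
      have := nrmD (y X - s) s; rewrite subrK -[X in _ <= X + _ -> _]nrmN opprB; lra.
    by have := nrmD (s - y X) (y X); rewrite subrK; lra.
  by move=> h; exact: (cvgM h h).
rewrite -/S -(fineK finS) -!EFinM !lee_fin; apply/andP; split.
  apply/ler_addgt0Pr => e e0; rewrite -lerBlDr.
  apply: (cvgr_to_ge nys).
  have [X hX] := tails _ (divr_gt0 e0 A0).
  apply: (filterS _ (above X)) => Y XY; apply: le_trans (y_lo Y).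
  have := ler_wpM2l (ltW A0) (hX Y XY).2.
  by rewrite mulrDr mulrCA divff ?lt0r_neq0// mulr1; lra.
apply: (cvgr_to_le nys); apply: (filterS _ (above fset0)) => Y _.
by apply: le_trans (y_up Y) _; rewrite ler_wpM2l.
Qed.

End RieszLimit.

(** * Selection of the subfamily *)

Lemma exists_subfset (T : choiceType) (X : {fset T}) (n : nat) : (n <= #|` X|)%N ->
  exists2 Y : {fset T}, (Y `<=` X)%fset & #|` Y| = n.
Proof.
move=> nX; exists [fset x in take n X]%fset.
  by apply/fsubsetP => x; rewrite !inE => /mem_take.
rewrite card_fseq undup_id ?take_uniq ?fset_uniq// size_take.
by case: ltnP nX => // h1 h2; apply/eqP; rewrite eqn_leq h1 h2.
Qed.

(** Continuity buys room: a slightly smaller [eps'] yields selections that are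
    larger by a definite factor, at an arbitrarily small loss in [c]. *)
Lemma exists_smaller_near (R : realType) (c : R -> R) (eps eta : R) :
    {within `]0, 1[, continuous c} -> 0 < eps < 1 -> 0 < eta ->
  exists2 eps' : R, 0 < eps' < eps & c eps - eta < c eps'.
Proof.
move=> cc /andP[e0 e1] eta0.
have ine : eps \in `]0, 1[%classic by rewrite inE /= in_itv /= e0 e1.
move: cc; rewrite continuous_open_subspace; last exact: interval_open.
move=> /(_ _ ine) /cvgrPdist_lt /(_ _ eta0) /nbhs_ballP[d /= d0 hd].
pose h := Num.min d eps / 2.
have h0 : 0 < h by rewrite divr_gt0// lt_min d0 e0.
have hd' : h < d by rewrite ltr_pdivrMr// gt_min; apply/orP; left; lra.
have he : h < eps by rewrite ltr_pdivrMr// gt_min; apply/orP; right; lra.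
exists (eps - h); first by apply/andP; split; lra.
have : `|c eps - c (eps - h)| < eta.
  by apply: hd; rewrite /ball /= opprB addrC subrK gtr0_norm.
by rewrite ltr_norml => /andP[]; lra.
Qed.

Section Selection.
Context (R : realType) (k : scalar_kind).
Local Notation K := (scalar_field R k).
Context (H : completeNormedModType K) (ip : {dot H for @scalar_conj R k}).
Hypothesis hH : hilbert_norm ip.
Context (d1 d2 : nat) (N : 'I_d2 -> nat).
Local Notation G := (fgab d1 N).
Context (g : G -> H).
Hypothesis hg : orthonormal_basis ip setT g.
Context (I : choiceType) (E : set I) (f : I -> H) (m : I -> G) (w : G -> R).
Hypothesis nE : forall e, E e -> nrm (f e) = 1.
Hypothesis w_ge0 : forall n, 0 <= w n.
Hypothesis w_sum : (\esum_(n in [set: G]) (w n)%:E < +oo)%E.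
Hypothesis f_loc : forall e n, E e -> nrm (ip (f e) (g n)) <= w (fgab_sub n (m e)).

Lemma coef_mass_loc e n : E e -> (coef_mass ip g f e n <= (w (fgab_sub n (m e)))%:E)%E.
Proof.
move=> Ee; rewrite lee_fin (le_trans _ (f_loc n Ee))// expr2 ler_piMr ?nrm_ge0//.
exact: (coef_le1 hH hg nE).
Qed.

(** A large cube around a common centre captures at least half of the unit mass
    of each member, while the upper density bounds the total mass in the cube. *)
Lemma finite_multiplicity : (upper_density ip g E f < +oo)%E ->
  exists C : R, forall p, (\esum_(e in E `&` [set e | m e == p]) (1 : \bar R) <= C%:E)%E.
Proof.
move=> /(local_density_upper hH hg nE (@subset_refl _ E))[x [A0 hx]].
have half0 : 0 < 2^-1 :> R by rewrite invr_gt0.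
have [L0 hL] := tail_small w_ge0 w_sum half0.
pose L := (A0 + L0)%N.
have htail := hL L (leq_addl _ _).
exists (2 * (x * (cube_card d1 N L)%:R)) => p.
set J := E `&` _.
have JE : J `<=` E by move=> e [].
have half1 : 2^-1 <= 1 :> R by lra.
have := count_le_mass (coef_mass_ge0 ip g f) w_ge0 (coef_mass_sum1 hH hg nE) coef_mass_loc
  0 p.1 JE half1 htail.
have -> : J `&` [set e | cube 0 p.1 (m e)] = J.
  apply/seteqP; split => [e []//|e Je]; split => //; case: Je => _ /= /eqP <-.
  exact: cube_center.
move=> h.
have {h} := le_trans h (le_trans (esum_subset JE _) (hx L p.1 (leq_addr _ _))).
move=> /(_ (fun e _ => esum_ge0 (fun n _ => coef_mass_ge0 ip g f e n))).
rewrite (_ : 1 - 2^-1 = 2^-1); last by lra.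
by move=> /(lee_div_mul half0); rewrite invrK mulrC.
Qed.

Lemma finite_members C (A : nat) q :
    (forall p, (\esum_(e in E `&` [set e | m e == p]) (1 : \bar R) <= C%:E)%E) ->
  finite_set (E `&` [set e | cube A q (m e)]).
Proof.
move=> hC; apply: (@sub_finite_set _ _
    (\bigcup_(p in (cube A q : set G)) (E `&` [set e | m e == p]))).
  by move=> e [Ee /= he]; exists (m e) => //; split => //=.
apply: bigcup_finite; first exact: cube_finite.
by move=> p _; apply: (@esum1_finite R); apply: le_lt_trans (hC p) (ltry _).
Qed.

End Selection.

Section UniformSelection.
Context (R : realType) (k : scalar_kind).
Local Notation K := (scalar_field R k).
Context (H : completeNormedModType K) (ip : {dot H for @scalar_conj R k}).
Hypothesis hH : hilbert_norm ip.
Context (c : R -> R).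
Hypothesis hc : finite_restricted_invertibility k c.
Context (E : set H) (T : {linear H -> H}).
Hypothesis oE : forall e f, E e -> E f -> ip e f = (e == f)%:R.
Hypothesis hT : bounded_operator T.
Hypothesis nT : forall e, E e -> nrm (T e) = 1.
Local Notation opT := (opnorm (@nrm R k H) T).

Lemma lower_bound_subset (b : R) (X Y : {fset H}) : (Y `<=` X)%fset ->
    (forall a : H -> K, b * \sum_(e <- X) nrm (a e) ^+ 2 <=
       nrm (\sum_(e <- X) a e *: T e) ^+ 2) ->
  forall a : H -> K, b * \sum_(e <- Y) nrm (a e) ^+ 2 <=
    nrm (\sum_(e <- Y) a e *: T e) ^+ 2.
Proof.
move=> YX hX a; have := hX (fun e => if e \in Y then a e else 0).
have sumY (V : nmodType) (F : H -> V) :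
    \sum_(e <- X) (if e \in Y then F e else 0) = \sum_(e <- Y) F e.
  rewrite -big_mkcond big_fset_condE /=; congr (\sum_(e <- _) _).
  congr (enum_fset _); apply/fsetP => e; rewrite !inE.
  by apply/andP/idP => [[]//|eY]; split => //; exact: (fsubsetP YX).
rewrite (eq_bigr (fun e => if e \in Y then nrm (a e) ^+ 2 else 0)); last first.
  by move=> e _; case: ifP => // _; rewrite nrm0 expr0n.
rewrite [in X in _ <= X -> _](eq_bigr (fun e => if e \in Y then a e *: T e else 0)).
  by rewrite !sumY.
by move=> e _; case: ifP => // _; rewrite scale0r.
Qed.

(** Trimming all selections to the smallest cardinality that occurs keeps the
    guaranteed proportion and makes the count the same everywhere. *)
Lemma uniform_restricted_invertibility (eps nu : R) (Q : Type) (q0 : Q)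
    (A : Q -> {fset H}) : 0 < eps < 1 ->
    (forall q, [set` A q] `<=` E) -> (forall q, nu <= #|` A q|%:R) ->
  exists n : nat, exists J : Q -> {fset H},
    [/\ (1 - eps) / opT ^+ 2 * nu <= n%:R,
        forall q, (J q `<=` A q)%fset,
        forall q, #|` J q| = n &
        forall q (a : H -> K), c eps * \sum_(e <- J q) nrm (a e) ^+ 2 <=
          nrm (\sum_(e <- J q) a e *: T e) ^+ 2].
Proof.
move=> heps AE hnu.
have ri q : exists J : {fset H},
    [/\ (J `<=` A q)%fset, (1 - eps) / opT ^+ 2 * #|` A q|%:R <= #|` J|%:R &
        forall a : H -> K, c eps * \sum_(e <- J) nrm (a e) ^+ 2 <=
          nrm (\sum_(e <- J) a e *: T e) ^+ 2].
  apply: (restricted_invertibility_hilbert hH hc hT heps).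
    by move=> e e' /AE Ee /AE Ee'; exact: oE.
  by move=> e /AE /nT.
have [J hJ] := choice ri.
have exn : exists n, `[< exists q, #|` J q| = n >].
  by exists #|` J q0|; apply/asboolP; exists q0.
have [n /asboolP[q1 hq1] hmin] := ex_minnP exn.
have trim q : exists Y : {fset H}, (Y `<=` J q)%fset /\ #|` Y| = n.
  have nq : (n <= #|` J q|)%N by apply: hmin; apply/asboolP; exists q.
  by have [Y YJ cY] := exists_subfset nq; exists Y.
have [Y hY] := choice trim.
exists n, Y; split=> [|q|q|q].
- rewrite -hq1; have [_ h _] := hJ q1; apply: le_trans h.
  rewrite ler_wpM2l// divr_ge0 ?sqr_ge0//.
  by case/andP: heps => _ /ltW; rewrite subr_ge0.
- by have [h1 _] := hY q; have [h2 _ _] := hJ q; exact: fsubset_trans h1 h2.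
- by have [_ ->] := hY q.
- by apply: lower_bound_subset; [have [h _] := hY q; exact: h|have [_ _ h] := hJ q].
Qed.

End UniformSelection.

Theorem theorem3p11
  (R : realType) (k : scalar_kind) (c : R -> R)
  (hc : finite_restricted_invertibility k c)
  (H : completeNormedModType (scalar_field R k)) (ip : {dot H for @scalar_conj R k})
  (hH : hilbert_norm ip)
  (d1 d2 : nat) (N : 'I_d2 -> nat)
  (E : set H) (hE : orthonormal_basis ip E id)
  (g : fgab d1 N -> H) (hg : orthonormal_basis ip setT g)
  (T : {linear H -> H}) (hT : bounded_operator T)
  (hTE : forall e, E e -> nrm (T e) = 1)
  (hloc : l1_localized ip g E T)
  (hlow : (0 < lower_density ip g E T)%E)
  (hle : (lower_density ip g E T <= upper_density ip g E T)%E)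
  (hup : (upper_density ip g E T < +oo)%E)
  (eps delta : R) (heps : 0 < eps < 1) (hdelta : 0 < delta < 1) :
  exists2 E' : set H, E' `<=` E &
    [/\ uniform_density ip g E' T,
        (((1 - eps) / opnorm (@nrm R k H) T ^+ 2)%:E
          <= relative_upper_density ip g E' E T)%E &
        riesz_sequence E' T (c eps * (1 - delta)) (opnorm (@nrm R k H) T ^+ 2)].
Proof.
set opT := opnorm _ _.
have [r rsum rloc] := hloc.
pose w n : R := `|r n|.
have w0 n : 0 <= w n by exact: normr_ge0.
have wsum : (\esum_(n in [set: fgab d1 N]) (w n)%:E < +oo)%E by exact: rsum.
have [m hm] : exists m : H -> fgab d1 N, forall e n, E e ->
    nrm (ip (T e) (g n)) <= w (fgab_sub n (m e)).
  have ex e : exists p, forall n, E e -> nrm (ip (T e) (g n)) <= w (fgab_sub n p).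
    have [Ee|nEe] := pselect (E e); last by exists (fgab0 d1 N) => n /nEe.
    have [p hp] := rloc e Ee; exists p => n _.
    exact: le_trans (hp n) (ler_norm _).
  by have [m hm] := choice ex; exists m => e n; exact: hm.
have [C hC] := finite_multiplicity hH hg hTE w0 wsum hm hup.
have C0 := multiplicity_ge0 hC.
have qloc := coef_mass_loc hH hg hTE hm.
have qsum := coef_mass_sum1 hH hg hTE.
have qge0 := coef_mass_ge0 ip g T.
have [D lowE] : exists D : R, lower_density ip g E T = D%:E.
  have : lower_density ip g E T \is a fin_num.
    by rewrite ge0_fin_numE ?(le_lt_trans hle hup)// ltW.
  by move/fineK <-; eexists.
have D0 : 0 < D by rewrite -lte_fin -lowE.
(* An empty family has lower density zero. *)
have [e0 Ee0] : exists e, E e.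
  apply: contrapT => noE; have E0 : E = set0.
    by apply/seteqP; split => // e Ee; apply: noE; exists e.
  have hD2 : ((D / 2)%:E < lower_density ip g E T)%E by rewrite lowE lte_fin; lra.
  have [A0 hA0] := local_density_lower hH hg hTE (@subset_refl _ E) hD2.
  have := hA0 A0 (fgab0 d1 N).1 (leqnn _); rewrite {1}E0 esum_set0 lee_fin leNgt.
  by rewrite mulr_gt0 ?ltr0n ?cube_card_gt0// divr_gt0.
have op1 : 1 <= opT.
  rewrite -(hTE _ Ee0) (le_trans (nrm_le_opnorm hT e0))//.
  by rewrite (orthonormal_nrm hH hE.1 Ee0) mulr1.
have op2_gt0 : 0 < opT ^+ 2 by rewrite exprn_gt0// (lt_le_trans ltr01).
have [cpos ccont _ _] := hc.
have /andP[ce0 ce1] := cpos _ heps.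
have /andP[de0 de1] := hdelta.
(* [theta] is allowed twice: for passing from [eps] to [eps'], and for the
   interaction between different tiles. *)
pose theta := c eps * delta / 2.
have theta0 : 0 < theta by rewrite divr_gt0// mulr_gt0.
have [eps' /andP[e'0 e'e] hc'] := exists_smaller_near ccont heps theta0.
have heps' : 0 < eps' < 1 by rewrite e'0 (lt_trans e'e)//; case/andP: heps.
(* Three relative losses of density are spent: the approximation of the lower
   density, the tails, and the layers between the tiles. *)
pose eta := (eps - eps') / 3.
have eta0 : 0 < eta by rewrite /eta; lra.
have epsE : eps = eps' + 3 * eta by rewrite /eta; field.
clearbody eta.
pose W := fine (\esum_(n in [set: fgab d1 N]) (w n)%:E).
have wsum0 : (0 <= \esum_(n in [set: fgab d1 N]) (w n)%:E)%E.
  by apply: esum_ge0 => n _; rewrite lee_fin.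
have hW : (\esum_(n in [set: fgab d1 N]) (w n)%:E <= W%:E)%E.
  by rewrite /W fineK// ge0_fin_numE.
have W0 : 0 <= W by exact: fine_ge0.
pose t := Num.min (theta / (2 * C * W + 1)) (eta * D / (C + 1)).
have CW0 : 0 < 2 * C * W + 1 by rewrite ltr_wpDl// !mulr_ge0.
have C1 : 0 < C + 1 by rewrite ltr_wpDl.
have t0 : 0 < t by rewrite lt_min !divr_gt0// mulr_gt0.
have t_theta : 2 * C * W * t <= theta.
  have : t * (2 * C * W + 1) <= theta by rewrite -ler_pdivlMr// ge_min lexx.
  by lra.
have t_eta : C * t <= eta * D.
  have : t * (C + 1) <= eta * D by rewrite -ler_pdivlMr// ge_min lexx orbT.
  by lra.
have [L hL] := tail_small w0 wsum t0.
have {hL} hL := hL L (leqnn _).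
have [A1 hA1] := cube_card_ratio d1 N (3 * L)%N eta0.
have hxD : ((D * (1 - eta))%:E < lower_density ip g E T)%E.
  by rewrite lowE lte_fin; have := mulr_gt0 eta0 D0; lra.
have [A2 hA2] := local_density_lower hH hg hTE (@subset_refl _ E) hxD.
pose A := (A1 + A2)%N.
(* Only members centred in the inner cube of radius [A + L] of a tile compete;
   members of different tiles then have centres more than [2 * L] apart. *)
pose rho := (A + 3 * L)%N.
pose inner q := E `&` [set e | cube (A + L) (tile_center rho q) (m e)].
have inner_fin q : finite_set (inner q) by exact: finite_members hC.
pose a : R := (cube_card d1 N A)%:R.
pose V : R := (cube_card d1 N rho)%:R.
have a0 : 0 <= a by exact: ler0n.
have V0 : 0 < V by rewrite ltr0n cube_card_gt0.
have haV : (1 - eta) * V <= a by apply: hA1; exact: leq_addr.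
(* The bound on the number of candidates per tile: density times the volume of
   the cube of radius [A], minus the mass that enters it from outside. *)
pose nu := D * (1 - 2 * eta) * a.
have hnu q : nu <= #|` fset_set (inner q)|%:R.
  have h1 := hA2 A (tile_center rho q) (leq_addl _ _).
  have h2 := mass_le_count qge0 w0 qsum qloc A (tile_center rho q) hC (@subset_refl _ E) hL.
  have := le_trans h1 h2; rewrite -/(inner q) esum1_card// -EFinD lee_fin -/a.
  have : C * t * a <= eta * D * a by rewrite ler_wpM2r.
  by rewrite /nu; lra.
have innerE q : [set` fset_set (inner q)] `<=` E.
  by move=> e /=; rewrite in_fset_set// inE => -[].
have [n [J [hn JA cJ hJ]]] :=
  uniform_restricted_invertibility hH hc hE.1 hT hTE [ffun=> 0] heps' innerE hnu.
have Jinner q e : e \in J q -> inner q e.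
  by move=> /(fsubsetP (JA q)); rewrite in_fset_set// inE.
have JE q e : e \in J q -> E e by move=> /Jinner[].
have Jtile q e : e \in J q -> tile rho (m e) = q.
  move=> /Jinner[_ /= h].
  have : cube rho (tile_center rho q) (m e) by apply: cube_le h; rewrite leq_add2l leq_pmull.
  by rewrite -tileE.
pose E' : set H := [set e | e \in J (tile rho (m e))].
have E'E : E' `<=` E by move=> e /JE.
have count q : (\esum_(e in E' `&` [set e | tile rho (m e) == q]) (1 : \bar R) = n%:R%:E)%E.
  rewrite -(cJ q) -esum1_fset; congr esum; apply/seteqP; split => e /=.
    by move=> [+ /eqP] => + <-.
  by move=> eJ; rewrite /E' /= (Jtile _ _ eJ).
have [lowE' upE'] := density_of_asymptotics hH hg hTE E'E
  (tiled_mass_asymptotics qge0 w0 qsum qloc wsum hC E'E count).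
exists E' => //; split.
- by rewrite /uniform_density lowE' upE'.
- rewrite /relative_upper_density upE' lowE /= -EFinM lee_fin -/V.
  rewrite ler_pdivlMr// ler_pdivlMr//; apply: le_trans hn.
  rewrite -mulrA mulrAC [leRHS]mulrAC ler_wpM2r ?invr_ge0 ?(ltW op2_gt0)// /nu.
  have /andP[_ e1] := heps.
  have h1 : (1 - 2 * eta) * ((1 - eta) * V) <= (1 - 2 * eta) * a.
    by rewrite ler_wpM2l//; lra.
  have h2 : (1 - eps) * V <= (1 - eps') * ((1 - 2 * eta) * a).
    apply: (@le_trans _ _ ((1 - eps') * ((1 - 2 * eta) * ((1 - eta) * V)))); last first.
      by rewrite ler_wpM2l//; lra.
    rewrite !mulrA ler_wpM2r ?(ltW V0)//.
    have p1 : 0 <= eps' * eta by rewrite mulr_ge0// ltW.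
    have p2 : 0 <= eta ^+ 2 * (1 - eps') by rewrite mulr_ge0 ?sqr_ge0//; lra.
    by lra.
  by have := ler_wpM2l (ltW D0) h2; lra.
- have cd0 : 0 < c eps * (1 - delta) by rewrite mulr_gt0//; lra.
  have cd1 : c eps * (1 - delta) <= opT ^+ 2.
    apply: (@le_trans _ _ 1); last by rewrite expr_ge1// (le_trans ler01).
    by rewrite mulr_ile1//; lra.
  apply: (riesz_sequence_finite hH hE.1 hT E'E cd0 cd1) => F b FE'.
  apply: (@le_trans _ _ ((c eps' - theta) * \sum_(e <- F) nrm (b e) ^+ 2)).
    apply: ler_wpM2r; first by apply: sumr_ge0 => e _; exact: sqr_ge0.
    by move: hc'; rewrite /theta; lra.
  pose tau e := tile rho (m e).
  apply: (nrm_sqr_sum_blocks hH (tau := tau)) => [q|e eF].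
    rewrite big_fset_condE [in leRHS]big_fset_condE /=.
    apply: (lower_bound_subset _ (hJ q)); apply/fsubsetP => e.
    rewrite !inE => /andP[/FE' /= h /eqP <-]; exact: h.
  have /= eE' := FE' e eF.
  pose S : set H := [set` [fset j in F | tau j != tau e]%fset].
  have SE : S `<=` E by move=> j; rewrite /S /= !inE => /andP[/FE' /E'E].
  have Sfar j : S j -> ~ cube (2 * L) (m e).1 (m j).
    rewrite /S /= !inE => /andP[jF /eqP tj] near; apply: tj.
    have [_ /= ce] := Jinner _ _ eE'.
    have rhoE : (2 * L + (A + L))%N = rho by rewrite /rho addnCA -mulSnr.
    by have := cube_trans near ce; rewrite rhoE -tileE.
  have := gram_row_far_le hH hg w0 hm hC hW hL (E'E _ eE') SE Sfar.
  rewrite /S esum_fset//; last by move=> j _; rewrite lee_fin nrm_ge0.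
  rewrite fsbig_finite//= set_fsetK sumEFin lee_fin => h.
  rewrite big_fset_condE /=.
  exact: le_trans h t_theta.
Qed.
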